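(* Let $0\le\alpha_0<\frac14$, $C^*>0$, $0\le\gamma<\frac12$, $\sigma_0>0$ be constants and let $c_0$ be the constant defined in the context. Suppose the sparsity levels $k,k_0$ satisfy $k\le c_0\min\{p^{\gamma},\frac{n}{\log p}\}$ and $k_0\le c_0\min\{k,\frac{\sqrt n}{\log p}\}$. (i) Let $\widehat\beta$ be any estimator such that for some $\theta_0=(\beta^*,\mathrm I,\sigma_0)\in\Theta_0(k)$ with $\|\beta^*\|_0\le k_0$, $$\mathbb P_{\theta_0}\Big(\|\widehat\beta-\beta^*\|_2^2> C^*\|\beta^*\|_0\tfrac{\log p}{n}\sigma_0^2\Big)\le\alpha_0 .$$ Then $$\inf_{\widehat L_2}\sup_{\theta\in\Theta_0(k)}\mathbb P_\theta\Big(\big|\widehat L_2-\|\widehat\beta-\beta(\theta)\|_2^2\big|\ge c\min\Big\{k\frac{\log p}{n},\frac1{\sqrt n}\Big\}\sigma_0^2\Big)\ge\delta .$$ (ii) Let $1\le q<2$ and let $\widehat\beta$ be any estimator such that for some $\beta^*\in\mathbb R^p$ with $\|\beta^*\|_0\le k_0$, $$\sup_{\theta=(\beta^*,\mathrm I,\sigma):\,\sigma\le2\sigma_0}\mathbb P_{\theta}\Big(\|\widehat\beta-\beta^*\|_q^2> C^*\|\beta^*\|_0^{2/q}\tfrac{\log p}{n}\sigma^2\Big)\le\alpha_0 .$$ Then $$\inf_{\widehat L_q}\sup_{\theta\in\Theta_0(k)}\mathbb P_\theta\Big(\big|\widehat L_q-\|\widehat\beta-\beta(\theta)\|_q^2\big|\ge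 c\,k^{2/q}\frac{\log p}{n}\sigma_0^2\Big)\ge\delta .$$ Here $\delta>0$ and $c>0$ are constants, and the infima are over all estimators (measurable functions of the data $Z$) of the loss.
   Context: Model: one observes $Z=(X,y)$ with $y=X\beta+\epsilon$, $X\in\mathbb R^{n\times p}$ with i.i.d. rows $X_{i\cdot}\sim N_p(0,\Sigma)$, $\epsilon\sim N_n(0,\sigma^2\mathrm I)$ independent of $X$. The parameter is $\theta=(\beta,\Sigma,\sigma)$, with $\sigma>0$ the noise standard deviation; $\beta(\theta)$ is its first component and $\mathbb P_\theta$ the law of $Z$. An estimator $\widehat\beta$ is a measurable function of $Z$. $\|x\|_0$ is the number of nonzero coordinates of $x$, $\|x\|_q$ the $\ell_q$ norm. Parameter space: $\Theta_0(k)=\{(\beta,\mathrm I,\sigma_0):\|\beta\|_0\le k\}$. Constant $c_0$: fix $0<\alpha<\frac14$, put $\epsilon_1=\frac{1-2\alpha-2\alpha_0}{12}$ and $$c_0=\min\Big\{\tfrac12,\;32\log(1+\epsilon_1^2),\;\tfrac23\sqrt{\log(1+\epsilon_1^2)},\;\tfrac{1-2\gamma}{16C^*},\;\big(\tfrac{1-2\gamma}{16C^*}\big)^2\Big\}.$$ Constants do not depend on $n,p$ or the sparsity levels.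
   Formalization: In (ii), when k=1 it is additionally assumed that log p ≤ √n; for k=1 and log p much larger than √n the printed bound fails, because 1-sparse vectors have equal ℓ_q and ℓ_2 norms and the loss can then be estimated at rate 1/√n. *)

(* Defs.v *)
From HB Require Import structures.
From mathcomp Require Import all_boot all_order all_algebra.
From mathcomp Require Import all_classical all_reals all_analysis.
From mathcomp Require Import measurable_realfun.
Import Order.TTheory GRing.Theory Num.Theory.
Import numFieldNormedType.Exports.

Set Implicit Arguments.
Unset Strict Implicit.
Unset Printing Implicit Defensive.

Local Open Scope classical_set_scope.
Local Open Scope ring_scope.

Section iid.
Context d (T : measurableType d) (R : realType) (P : probability T R).

Definition pcons (m : nat) (x : T * m.-tuple T) : m.+1.-tuple T :=
  [the m.+1.-tuple T of x.1 :: x.2].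

Lemma measurable_pcons m : measurable_fun setT (@pcons m).
Proof. exact: measurable_cons. Qed.

HB.instance Definition _ m :=
  isMeasurableFun.Build _ _ _ _ (@pcons m) (@measurable_pcons m).

(* The product probability P^m on T^m, by recursion P^(m+1) = P x P^m: the law
   of m independent random variables of law P. *)
Fixpoint iid (m : nat) : probability (m.-tuple T) R :=
  match m with
  | 0 => \d_ [tuple]
  | m'.+1 => distribution (P \x iid m')%E (@pcons m')
  end.

End iid.

(* Vectors and matrices are stored as tuples, which carry the product
   sigma-algebra; these are the corresponding algebraic objects. *)
Definition col_of_tuple (R : realType) (p : nat) (t : p.-tuple R) : 'cV[R]_p :=
  \col_j tnth t j.

Definition mx_of_tuple (R : realType) (n p : nat) (X : n.-tuple (p.-tuple R)) :
  'M[R]_(n, p) := \matrix_(i, j) tnth (tnth X i) j.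

Section normal.
Context (R : realType).

Lemma measurable_to_realType :
  measurable_fun setT (idfun : measurableTypeR R -> R).
Proof. by move=> _ A mA; rewrite setTI. Qed.

HB.instance Definition _ :=
  isMeasurableFun.Build _ _ _ _ (idfun : measurableTypeR R -> R)
    measurable_to_realType.

(* normal_prob lives on measurableTypeR R, which has the same sigma-algebra as
   R under another display. The second argument is the standard deviation; the
   library's convention makes normal_prob m 0 not normal. *)
Definition normal (m s : R) : probability R R :=
  distribution (normal_prob m s : probability (measurableTypeR R) R)
    (idfun : measurableTypeR R -> R).

End normal.

Section multivariate_normal.
Context (R : realType) (p : nat).

Definition psdmx (A : 'M[R]_p) : Prop :=
  A^T = A /\ forall u : 'cV[R]_p, 0 <= (u^T *m A *m u) 0 0.

(* The unique positive semidefinite square root when psdmx S, and 0 for any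
   other S. *)
Definition sqrtmx (S : 'M[R]_p) : 'M[R]_p :=
  xget 0 [set A | psdmx A /\ A *m A = S].

Definition tuple_mulmx (A : 'M[R]_p) (g : p.-tuple R) : p.-tuple R :=
  [tuple (A *m col_of_tuple g) j 0 | j < p].

Lemma measurable_tuple_mulmx A : measurable_fun setT (tuple_mulmx A).
Proof.
apply/measurable_fun_tnthP => j.
rewrite (_ : _ \o _ = fun g : p.-tuple R => \sum_k A j k * tnth g k).
  apply: measurable_sum => k; apply: measurable_funM => //.
  exact: measurable_tnth.
apply/funext => g; rewrite /= tnth_mktuple mxE.
by apply: eq_bigr => k _; rewrite mxE.
Qed.

HB.instance Definition _ A :=
  isMeasurableFun.Build _ _ _ _ (tuple_mulmx A) (measurable_tuple_mulmx A).

(* N_p(0, S), as the law of S^(1/2) g with g standard normal. *)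
Definition mvnormal (S : 'M[R]_p) : probability (p.-tuple R) R :=
  distribution (iid (normal 0 1) p) (tuple_mulmx (sqrtmx S)).

End multivariate_normal.

(* X and y of the data Z = (X, y), with X stored by rows. *)
Notation data R n p := (n.-tuple (p.-tuple R) * n.-tuple R)%type.

Section linear_model.
Context (R : realType) (n p : nat).

Record param := Param {
  beta : 'cV[R]_p;
  Sigma : 'M[R]_p;
  sigma : R }.

Definition observe (b : 'cV[R]_p) (Xe : data R n p) : data R n p :=
  (Xe.1, [tuple (mx_of_tuple Xe.1 *m b) i 0 + tnth Xe.2 i | i < n]).

Lemma measurable_observe b : measurable_fun setT (observe b).
Proof.
apply: measurable_fun_pair => //=; apply/measurable_fun_tnthP => i.
rewrite (_ : _ \o _ = fun Xe : data R n p =>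
    \sum_j tnth (tnth Xe.1 i) j * b j 0 + tnth Xe.2 i).
  apply: measurable_funD; last exact: (measurableT_comp (measurable_tnth i)).
  apply: measurable_sum => j; apply: measurable_funM => //.
  apply: (measurableT_comp (measurable_tnth j)).
  exact: (measurableT_comp (measurable_tnth i)).
apply/funext => Xe; rewrite /= tnth_mktuple mxE; congr (_ + _).
by apply: eq_bigr => j _; rewrite mxE.
Qed.

HB.instance Definition _ b :=
  isMeasurableFun.Build _ _ _ _ (observe b) (measurable_observe b).

Definition law (theta : param) : probability (data R n p) R :=
  distribution
    (iid (mvnormal (Sigma theta)) n \x
     iid (normal 0 (sigma theta)) n)%E
    (observe (beta theta)).

Definition l0norm (x : 'cV[R]_p) : nat := #|[set j | x j 0 != 0]%SET|.

Definition lqnorm (q : R) (x : 'cV[R]_p) : R :=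
  (\sum_j `|x j 0| `^ q) `^ q^-1.

Definition loss (q : R) (bhat : data R n p -> p.-tuple R) (b : 'cV[R]_p)
  (z : data R n p) : R := lqnorm q (col_of_tuple (bhat z) - b) ^+ 2.

Definition Theta0 (sigma0 : R) (k : nat) : set param :=
  [set theta | [/\ (l0norm (beta theta) <= k)%N, Sigma theta = 1%:M
                 & sigma theta = sigma0]].

Definition minimax_risk (q sigma0 : R) (k : nat)
  (bhat : data R n p -> p.-tuple R) (r : R) : \bar R :=
  ereal_inf [set ereal_sup
    [set law theta [set z | r <= `|L z - loss q bhat (beta theta) z|]
    | theta in Theta0 sigma0 k]
  | L in [set: {mfun data R n p >-> R}]].

End linear_model.

Definition c0 (R : realType) (alpha alpha0 gamma Cstar : R) : R :=
  let eps1 := (1 - 2 * alpha - 2 * alpha0) / 12 in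
  let l := ln (1 + eps1 ^+ 2) in
  let t := (1 - 2 * gamma) / (16 * Cstar) in
  Num.min 2^-1 (Num.min (32 * l) (Num.min (2 / 3 * Num.sqrt l)
    (Num.min t (t ^+ 2)))).

(* Main.v *)
(** The null hypothesis is the given b, with noise level s; the alternatives are
b + spike rho S with noise level sigma0, where S takes one coordinate from each
of #|S| blocks of equal size. Given two of these alternatives, the second moment
of their likelihood ratios against the null is an explicit function of
#|S :&: S'|, and its average over S, S' stays below 7/5 as long as
rho^2 <= (2/3) (1 - 2 gamma) sigma0^2 log p / n and either s = sigma0 and
n |spike|^4 is bounded by sigma0^4, or s^2 = sigma0^2 + |spike|^2. Hence an event
of constant probability under the null has constant probability under some
alternative. On an event of constant null probability the estimator bhat is close
to b, so that its loss at an alternative is about the q-norm of the spike; an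
estimator of the loss therefore fails as soon as two indistinguishable families
of spikes have different q-norms. With s = sigma0 the two families are a sparse
one and the zero vector; with s > sigma0 they have the same 2-norm, but one has
twice the support of the other, and q < 2 separates them. *)
Require Import Defs.
From mathcomp Require Import all_boot all_order all_algebra.
From mathcomp Require Import all_classical all_reals all_analysis.
From mathcomp Require Import measurable_realfun ring lra zify.
Import Order.TTheory GRing.Theory Num.Theory.

Set Implicit Arguments.
Unset Strict Implicit.
Unset Printing Implicit Defensive.

Local Open Scope classical_set_scope.
Local Open Scope ring_scope.

(** The factor 1 - 2 gamma comes from counting coincidences. With blocks of size m about p / k,
    [#|S :&: S'|] is a sum of k independent Bernoulli(1/m) variables, so its exponential moment
    factors over the blocks and is controlled by k e^t / m, about k^2 e^t / p. As k^2 is at most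
    p^(2 gamma) / 324, the exponent t may grow up to (1 - 2 gamma) log p. The error of [bhat] has to
    be small against the gap between the two families. For spikes against zero the gap is a fixed
    fraction of the squared norm of the spike, and [c0] is small enough for that. For two families
    of equal 2-norm the gap involves 2^(1/q - 1/2) - 1, which tends to 0 as q tends to 2, whereas
    [c0] does not depend on q. In (ii) the second construction is therefore kept for k above a large
    q-dependent multiple of min(k, sqrt n / log p), where b is so sparse that the error of [bhat] is
    negligible, or for this minimum below 1, where b = 0. Otherwise the first construction already
    gives the rate up to a constant. *)

(** * Integrals over i.i.d. tuples *)

Lemma integral_iid_cons d (T : measurableType d) (R : realType)
    (P : probability T R) m (f : m.+1.-tuple T -> \bar R) :
  measurable_fun setT f -> (forall t, 0 <= f t)%E ->
  (\int[iid P m.+1]_t f t = \int[P]_x \int[iid P m]_t f (pcons (x, t)))%E.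
Proof.
move=> mf f0.
rewrite ge0_integral_pushforward//=.
rewrite preimage_setT fubini_tonelli1//=.
exact: (measurableT_comp mf (@measurable_pcons _ T m)).
Qed.

Lemma measurable_fun_prod_tuple d (T : measurableType d) (R : realType) m
    (g : 'I_m -> T -> R) :
  (forall i, measurable_fun setT (g i)) ->
  measurable_fun setT (fun t : m.-tuple T => \prod_(i < m) g i (tnth t i)).
Proof.
move=> mg; apply: measurable_prod => i _.
exact: (measurableT_comp (mg i) (measurable_tnth i)).
Qed.

Lemma integral_iid_prod d (T : measurableType d) (R : realType)
    (P : probability T R) m (g : 'I_m -> T -> R) (c : 'I_m -> R) :
  (forall i, measurable_fun setT (g i)) -> (forall i x, 0 <= g i x) ->
  (forall i, \int[P]_x (g i x)%:E = (c i)%:E)%E ->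
  (\int[iid P m]_t (\prod_(i < m) g i (tnth t i))%:E = (\prod_i c i)%:E)%E.
Proof.
elim: m g c => [|m IH] g c mg g0 gc.
  rewrite big_ord0; under eq_integral do rewrite big_ord0.
  by rewrite integral_cst// mul1e; exact: probability_setT.
rewrite integral_iid_cons; last 2 first.
- by apply/measurable_EFinP; exact: measurable_fun_prod_tuple.
- by move=> t; rewrite lee_fin prodr_ge0.
transitivity (\int[P]_x ((g ord0 x)%:E *
    (\prod_(i < m) c (lift ord0 i))%:E))%E.
  apply: eq_integral => x _.
  under eq_integral => t _.
    rewrite big_ord_recl tnth0 /= EFinM.
    under eq_bigr do rewrite tnthS.
    over.
  rewrite ge0_integralZl_EFin//.
  - by rewrite (IH (fun i => g (lift ord0 i)) (fun i => c (lift ord0 i))).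
  - by move=> t _; rewrite lee_fin prodr_ge0.
  - apply/measurable_EFinP.
    exact: (measurable_fun_prod_tuple (fun i => mg (lift ord0 i))).
rewrite ge0_integralZr//.
- by rewrite gc big_ord_recl EFinM.
- exact/measurable_EFinP.
- by move=> x _; rewrite lee_fin.
- rewrite lee_fin prodr_ge0// => i _.
  by rewrite -lee_fin -gc integral_ge0// => x _; rewrite lee_fin.
Qed.

(** * One-dimensional normal laws and changes of density *)

(** The Radon-Nikodym derivative of the normal law agrees almost everywhere with [normal_pdf],
    because both have the same integral over every measurable set. *)
Lemma ge0_integral_normal (R : realType) (m s : R) (f : R -> \bar R) :
  measurable_fun setT f -> (forall x, 0 <= f x)%E ->
  (\int[normal m s]_x f x =
   \int[lebesgue_measure]_x (f x * (normal_pdf m s x)%:E))%E.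
Proof.
move=> mf f0; rewrite /normal ge0_integral_pushforward//=.
rewrite preimage_setT /comp/=.
have dom := normal_prob_dominates m s.
rewrite -(Radon_Nikodym_SigmaFinite.change_of_variables dom)//=.
apply: ae_eq_integral => //.
- apply: emeasurable_funM => //.
  exact: (measurable_int _ (Radon_Nikodym_SigmaFinite.f_integrable dom)).
- apply: emeasurable_funM => //.
  by apply/measurable_EFinP; exact: measurable_normal_pdf.
- apply: ae_eqe_mul2l.
  apply: integral_ae_eq => //.
  + exact: (Radon_Nikodym_SigmaFinite.f_integrable dom).
  + by apply/measurable_EFinP; exact: measurable_normal_pdf.
  + by move=> E _ mE; rewrite -Radon_Nikodym_SigmaFinite.f_integral.
Qed.

Lemma integral_lebesgue_shift (R : realType) (v : R) (f : R -> \bar R) :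
  measurable_fun setT f -> (forall x, 0 <= f x)%E ->
  (\int[lebesgue_measure]_x f (x + v)%R = \int[lebesgue_measure]_x f x)%E.
Proof.
move=> mf f0.
pose phi := (fun x => x + v) : measurableTypeR R -> measurableTypeR R.
have mphi : measurable_fun setT phi by exact: measurable_funD.
have E : setT = phi @^-1` setT by [].
rewrite [in LHS]E -[LHS](@ge0_integral_pushforward _ _ _ _ _ phi mphi lebesgue_measure setT f)//=.
apply: eq_measure_integral => //= A mA _.
apply/esym/lebesgue_measure_unique => //= _ [[a b]] _ <-.
rewrite /pushforward.
have -> : phi @^-1` `]a, b] = `]a - v, b - v]%classic.
  by apply/seteqP; split => x /=; rewrite !in_itv/= /phi ltrBlDr lerBrDr.
rewrite !lebesgue_measure_itv/= !lte_fin ltrD2r; case: ifP => // _.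
by rewrite -!EFinB; congr EFin; ring.
Qed.

(** The density of N(v, sg^2) divided by that of N(0, s^2), at [x]. *)
Definition lratio (R : realType) (sg s v x : R) : R :=
  s / sg * expR (- (x - v) ^+ 2 / (sg ^+ 2 *+ 2) + x ^+ 2 / (s ^+ 2 *+ 2)).

Lemma lratio_ge0 (R : realType) (sg s v x : R) :
  0 <= sg -> 0 <= s -> 0 <= lratio sg s v x.
Proof. by move=> sg0 s0; rewrite mulr_ge0 ?expR_ge0 ?divr_ge0. Qed.

Lemma measurable_lratio (R : realType) d (T : measurableType d) (sg s : R)
    (v x : T -> R) :
  measurable_fun setT v -> measurable_fun setT x ->
  measurable_fun setT (fun t => lratio sg s (v t) (x t)).
Proof.
move=> mv mx; apply: measurable_funM => //.
apply: measurableT_comp => //; apply: measurable_funD.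
- apply: measurable_funM => //; apply: measurableT_comp => //.
  by apply: measurable_funX; exact: measurable_funB.
- by apply: measurable_funM => //; apply: measurable_funX.
Qed.

Lemma normal_peak_ratio (R : realType) (sg s : R) : 0 < sg -> 0 < s ->
  normal_peak sg = s / sg * normal_peak s.
Proof.
move=> sg0 s0; rewrite /normal_peak.
have E (t : R) : 0 < t -> Num.sqrt (t ^+ 2 * pi *+ 2) = t * Num.sqrt (pi *+ 2).
  by move=> t0; rewrite -mulrnAr sqrtrM ?sqr_ge0// sqrtr_sqr gtr0_norm.
have pi0 : Num.sqrt (pi *+ 2 : R) != 0.
  by rewrite gt_eqF// sqrtr_gt0 pmulrn_lgt0// pi_gt0.
by rewrite !E//; field; rewrite pi0 !gt_eqF.
Qed.

Lemma integral_normal_shift (R : realType) (sg s v : R) (f : R -> \bar R) :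
  0 < sg -> 0 < s ->
  measurable_fun setT f -> (forall x, 0 <= f x)%E ->
  (\int[normal 0 sg]_x f (v + x)%R =
   \int[normal 0 s]_x (f x * (lratio sg s v x)%:E))%E.
Proof.
move=> sg0 s0 mf f0.
rewrite ge0_integral_normal//; last first.
  by apply: (measurableT_comp mf); exact: measurable_funD.
rewrite ge0_integral_normal//; last 2 first.
- apply: emeasurable_funM => //; apply/measurable_EFinP.
  exact: measurable_lratio.
- by move=> x; rewrite mule_ge0// lee_fin lratio_ge0// ltW.
rewrite -(integral_lebesgue_shift v (f := fun x => f x * (lratio sg s v x)%:E *
    (normal_pdf 0 s x)%:E)%E); last 2 first.
- apply: emeasurable_funM; last by apply/measurable_EFinP; exact: measurable_normal_pdf.
  apply: emeasurable_funM => //; apply/measurable_EFinP.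
  exact: measurable_lratio.
- move=> x; rewrite !mule_ge0// lee_fin ?lratio_ge0 ?normal_pdf_ge0// ltW//.
apply: eq_integral => x _; rewrite addrC -muleA -EFinM; congr (_ * _%:E)%E.
rewrite !normal_pdfE ?gt_eqF// (normal_peak_ratio sg0 s0) /lratio /normal_fun.
rewrite mulrACA -expRD -!mulrA; congr (_ * (_ * (_ * expR _))).
by field; rewrite !gt_eqF.
Qed.

(** Completing the square turns the integrand times the density of N(0, s^2) into a multiple of the
    density of N(b s'^2, s'^2), where s' = s / sqrt (1 + a s^2). *)
Lemma integral_normal_expR (R : realType) (s a b : R) :
  0 < s -> 0 < 1 + a * s ^+ 2 ->
  (\int[normal 0 s]_x (expR (- (a * x ^+ 2) / 2 + b * x))%:E =
   ((Num.sqrt (1 + a * s ^+ 2))^-1 *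
     expR (b ^+ 2 * s ^+ 2 / (2 * (1 + a * s ^+ 2))))%:E)%E.
Proof.
move=> s0; set w := 1 + _ => w0.
have sw0 : 0 < Num.sqrt w by rewrite sqrtr_gt0.
pose s' := s / Num.sqrt w.
have s'0 : 0 < s' by rewrite divr_gt0.
have s'2 : s' ^+ 2 = s ^+ 2 / w by rewrite expr_div_n sqr_sqrtr// ltW.
rewrite ge0_integral_normal//; last first.
  apply/measurable_EFinP; apply: measurableT_comp => //.
  apply: measurable_funD; last exact: measurable_funM.
  apply: measurable_funM => //; apply: measurableT_comp => //.
  by apply: measurable_funM => //; exact: measurable_funX.
rewrite -[RHS]mule1 -(integral_normal_pdf (b * s' ^+ 2) s').
rewrite -ge0_integralZl_EFin//; last 2 first.
- by move=> x _; rewrite lee_fin normal_pdf_ge0.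
- by apply/measurable_EFinP; exact: measurable_normal_pdf.
apply: eq_integral => x _; rewrite -!EFinM; congr EFin.
rewrite !normal_pdfE ?gt_eqF// (normal_peak_ratio s0 s'0) /normal_fun.
have -> : s' / s = (Num.sqrt w)^-1 by rewrite /s'; field; rewrite !gt_eqF.
rewrite mulrCA -expRD -[RHS]mulrA [X in _ = _ * X]mulrCA -expRD [RHS]mulrA.
congr (_ * expR _); rewrite s'2 /w.
by field; rewrite !gt_eqF.
Qed.

(** [tau] and [w] depend on the index because, for a given design, each observation is shifted by
    its own amount. *)
Lemma integral_iid_change d (T : measurableType d) (R : realType)
    (P Q : probability T R) n (tau : 'I_n -> T -> T) (w : 'I_n -> T -> R)
    (f : n.-tuple T -> \bar R) :
  (forall i, measurable_fun setT (tau i)) ->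
  (forall i, measurable_fun setT (w i)) -> (forall i x, 0 <= w i x) ->
  (forall i (g : T -> \bar R), measurable_fun setT g -> (forall x, 0 <= g x)%E ->
    \int[P]_x g (tau i x) = \int[Q]_x (g x * (w i x)%:E))%E ->
  measurable_fun setT f -> (forall t, 0 <= f t)%E ->
  (\int[iid P n]_e f [tuple tau i (tnth e i) | i < n] =
   \int[iid Q n]_e (f e * (\prod_(i < n) w i (tnth e i))%:E))%E.
Proof.
elim: n tau w f => [|n IH] tau w f mtau mw w0 tauw mf f0.
  have I0 S (g : 0.-tuple T -> \bar R) : measurable_fun setT g ->
      (\int[iid S 0]_t g t = g [tuple])%E.
    by move=> mg; rewrite integral_dirac// diracT mul1e.
  have mtuple (h : 0.-tuple T -> 0.-tuple T) : measurable_fun setT h.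
    by apply/measurable_fun_tnthP => -[].
  rewrite (I0 P)/=; last exact: (measurableT_comp mf (mtuple _)).
  rewrite (I0 Q).
  - by rewrite big_ord0 mule1; congr f; apply: eq_from_tnth => -[].
  - apply: emeasurable_funM => //; apply/measurable_EFinP.
    exact: measurable_fun_prod_tuple.
pose tau' (i : 'I_n) := tau (lift ord0 i).
pose w' (i : 'I_n) := w (lift ord0 i).
pose G (z : T * n.-tuple T) :=
  (f (pcons z) * (\prod_(i < n) w' i (tnth z.2 i))%:E)%E.
have mprod : measurable_fun setT
    (fun t : n.-tuple T => (\prod_(i < n) w' i (tnth t i))%:E).
  apply/measurable_EFinP; apply: measurable_fun_prod_tuple => i; exact: mw.
have mG : measurable_fun setT G.
  apply: emeasurable_funM.
  - exact: (measurableT_comp mf (@measurable_pcons _ _ n)).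
  - exact: (measurableT_comp mprod measurable_snd).
have G0 z : (0 <= G z)%E.
  by rewrite mule_ge0// lee_fin prodr_ge0// => i _; exact: w0.
pose F y := (\int[iid Q n]_t G (y, t))%E.
have mF : measurable_fun setT F.
  exact: (@measurable_fun_fubini_tonelli_F _ _ _ _ _ (iid Q n) G mG G0).
have F0 y : (0 <= F y)%E by apply: integral_ge0.
have mft : measurable_fun setT
    (fun e : n.+1.-tuple T => f [tuple tau i (tnth e i) | i < n.+1]).
  apply: (measurableT_comp mf); apply/measurable_fun_tnthP => i.
  rewrite (_ : _ \o _ = fun e : n.+1.-tuple T => tau i (tnth e i)).
    exact: (measurableT_comp (mtau i) (measurable_tnth i)).
  by apply/funext => e; rewrite /= tnth_mktuple.
rewrite (integral_iid_cons _ mft)//.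
transitivity (\int[P]_x F (tau ord0 x))%E.
  apply: eq_integral => x _; rewrite /F /G /=.
  rewrite -(IH tau' w' (fun t => f (pcons (tau ord0 x, t))))//.
  - apply: eq_integral => t _; congr (f _).
    apply: eq_from_tnth => i; rewrite tnth_mktuple.
    case: (unliftP ord0 i) => [j|] ->; last by rewrite !tnth0.
    by rewrite !tnthS tnth_mktuple.
  - by move=> i; exact: mtau.
  - by move=> i; exact: mw.
  - by move=> i y; exact: w0.
  - by move=> i g; exact: tauw.
  - apply: (measurableT_comp mf).
    exact: (measurableT_comp (@measurable_pcons _ _ n) (measurable_fun_pair _ _)).
rewrite tauw// integral_iid_cons; last 2 first.
- apply: emeasurable_funM => //; apply/measurable_EFinP.
  exact: measurable_fun_prod_tuple.
- by move=> t; rewrite mule_ge0// lee_fin prodr_ge0.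
apply: eq_integral => x _; rewrite /F -ge0_integralZr//; last 2 first.
- exact: (measurableT_comp mG (measurable_fun_pair _ _)).
- by rewrite lee_fin.
apply: eq_integral => t _; rewrite /G -muleA -EFinM; congr (_ * _%:E)%E.
rewrite big_ord_recl tnth0 mulrC; congr (_ * _).
by apply: eq_bigr => i _; rewrite tnthS.
Qed.

Lemma integral_iid_normal_shift (R : realType) (sg s : R) n (v : 'I_n -> R)
    (f : n.-tuple R -> \bar R) :
  0 < sg -> 0 < s -> measurable_fun setT f -> (forall t, 0 <= f t)%E ->
  (\int[iid (normal 0 sg) n]_e f [tuple (v i + tnth e i)%R | i < n] =
   \int[iid (normal 0 s) n]_e
     (f e * (\prod_(i < n) lratio sg s (v i) (tnth e i))%:E))%E.
Proof.
move=> sg0 s0.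
apply: (integral_iid_change (tau := fun i x => v i + x)
  (w := fun i => lratio sg s (v i))).
- by move=> i; exact: measurable_funD.
- move=> i; exact: (@measurable_lratio R _ _ sg s (cst (v i)) idfun
    (@measurable_cst _ _ _ _ setT _) (@measurable_id _ _ setT)).
- by move=> i x; rewrite lratio_ge0// ltW.
- by move=> i g mg g0; exact: integral_normal_shift.
Qed.

(** * Bivariate Gaussian integrals *)

(** The unnormalised centred normal density exp(- t^T M^-1 t / 2) with covariance M = (m11, m12;
    m12, m22), the inverse being written as adjugate over determinant. *)
Definition gauss2 (R : realType) (m11 m12 m22 t1 t2 : R) : R :=
  expR (- (m22 * t1 ^+ 2 - 2 * m12 * t1 * t2 + m11 * t2 ^+ 2) /
    (2 * (m11 * m22 - m12 ^+ 2))).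

Lemma measurable_gauss2 (R : realType) d (T : measurableType d)
    (m11 m12 m22 : R) (t1 t2 : T -> R) :
  measurable_fun setT t1 -> measurable_fun setT t2 ->
  measurable_fun setT (fun x => gauss2 m11 m12 m22 (t1 x) (t2 x)).
Proof.
move=> mt1 mt2; apply: measurableT_comp => //; apply: measurable_funM => //.
apply: measurableT_comp => //; apply: measurable_funD.
  apply: measurable_funB; first by apply: measurable_funM => //; exact: measurable_funX.
  by do 2 (apply: measurable_funM => //).
by apply: measurable_funM => //; exact: measurable_funX.
Qed.

(** The form is w^T adj(M) w, the increase of det M under the rank-one update M + w w^T. *)
Lemma quad_form_ge0 (R : realType) (m11 m12 m22 w1 w2 : R) :
  0 < m11 -> 0 < m11 * m22 - m12 ^+ 2 ->
  0 <= m22 * w1 ^+ 2 - 2 * m12 * w1 * w2 + m11 * w2 ^+ 2.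
Proof.
move=> h1 hD; rewrite -(pmulr_rge0 _ h1).
have -> : m11 * (m22 * w1 ^+ 2 - 2 * m12 * w1 * w2 + m11 * w2 ^+ 2) =
  (m11 * w2 - m12 * w1) ^+ 2 + (m11 * m22 - m12 ^+ 2) * w1 ^+ 2 by ring.
by rewrite addr_ge0 ?sqr_ge0// mulr_ge0 ?sqr_ge0// ltW.
Qed.

(** Adding an independent multiple g (w1, w2) to a centred Gaussian pair of covariance M produces
    covariance M + w w^T; the square root makes up for [gauss2] being unnormalised. *)
Lemma integral_normal_gauss2 (R : realType) (m11 m12 m22 w1 w2 t1 t2 : R) :
  let D := m11 * m22 - m12 ^+ 2 in
  let n11 := m11 + w1 ^+ 2 in
  let n12 := m12 + w1 * w2 in
  let n22 := m22 + w2 ^+ 2 in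
  let D' := n11 * n22 - n12 ^+ 2 in
  0 < m11 -> 0 < D ->
  (\int[normal 0 1]_g (gauss2 m11 m12 m22 (t1 - g * w1) (t2 - g * w2))%:E =
   (Num.sqrt (D / D') * gauss2 n11 n12 n22 t1 t2)%:E)%E.
Proof.
move=> D n11 n12 n22 D' h1 hD.
(* Here a = w^T M^-1 w and b = t^T M^-1 w are the coefficients of the exponent as a polynomial in
   g. *)
pose a := (m22 * w1 ^+ 2 - 2 * m12 * w1 * w2 + m11 * w2 ^+ 2) / D.
pose b := (m22 * t1 * w1 - m12 * (t1 * w2 + t2 * w1) + m11 * t2 * w2) / D.
have D'E : D' = D * (1 + a).
  rewrite mulrDr mulr1 /a mulrCA divff ?gt_eqF// mulr1 /D' /D /n11 /n12 /n22; ring.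
have a0 : 0 <= a by rewrite divr_ge0 ?quad_form_ge0// ltW.
have a1 : 0 < 1 + a by rewrite ltr_pwDl.
have D'0 : 0 < D' by rewrite D'E mulr_gt0.
transitivity (\int[normal 0 1]_g ((gauss2 m11 m12 m22 t1 t2)%:E *
    (expR (- (a * g ^+ 2) / 2 + b * g))%:E))%E.
  apply: eq_integral => g _; rewrite -EFinM /gauss2 -expRD; congr (expR _)%:E.
  rewrite /a /b -/D; field; by rewrite gt_eqF.
rewrite ge0_integralZl_EFin//; last 2 first.
- apply/measurable_EFinP; apply: measurableT_comp => //.
  apply: measurable_funD; last exact: measurable_funM.
  apply: measurable_funM => //; apply: measurableT_comp => //.
  by apply: measurable_funM => //; exact: measurable_funX.
- exact: expR_ge0.
have a1' : 0 < 1 + a * 1 ^+ 2 by rewrite expr1n mulr1.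
rewrite (integral_normal_expR b ltr01 a1') expr1n !mulr1 -EFinM; congr EFin.
rewrite mulrCA; congr (_ * _).
  by rewrite D'E invfM mulrA divff ?gt_eqF// mul1r sqrtrV// ltW.
rewrite /gauss2 -expRD -/D -/D'; congr expR; rewrite D'E.
have nz : 1 + a != 0 by rewrite gt_eqF.
have DZ : D != 0 by rewrite gt_eqF.
rewrite /n11 /n12 /n22.
have aE : a * D = m22 * w1 ^+ 2 - 2 * m12 * w1 * w2 + m11 * w2 ^+ 2.
  by rewrite /a divfK.
have bE : b * D = m22 * t1 * w1 - m12 * (t1 * w2 + t2 * w1) + m11 * t2 * w2.
  by rewrite /b divfK.
(* Lagrange's identity for the form adj(M): the square of its bilinear value at t and w is Q(t) Q(w)
   - det(M) (w1 t2 - w2 t1)^2. *)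
have bb : b ^+ 2 * D ^+ 2 =
   (m22 * t1 ^+ 2 - 2 * m12 * t1 * t2 + m11 * t2 ^+ 2) * (a * D) -
   D * ((m22 * t1 ^+ 2 - 2 * m12 * t1 * t2 + m11 * t2 ^+ 2) * 0 +
     (w1 * t2 - w2 * t1) ^+ 2).
  by rewrite -exprMn bE aE /D; ring.
set Q := m22 * t1 ^+ 2 - 2 * m12 * t1 * t2 + m11 * t2 ^+ 2 in bb *.
have -> : (m22 + w2 ^+ 2) * t1 ^+ 2 - 2 * (m12 + w1 * w2) * t1 * t2 +
   (m11 + w1 ^+ 2) * t2 ^+ 2 = Q + (w1 * t2 - w2 * t1) ^+ 2 by rewrite /Q; ring.
have -> : (w1 * t2 - w2 * t1) ^+ 2 = Q * a - b ^+ 2 * D.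
  apply: (mulfI DZ); rewrite mulrBr.
  have -> : D * (b ^+ 2 * D) = b ^+ 2 * D ^+ 2 by ring.
  by rewrite bb; ring.
by field; rewrite nz DZ.
Qed.

Lemma det2_gt0 (R : realType) (m11 m12 m22 w1 w2 : R) :
  0 < m11 -> 0 < m11 * m22 - m12 ^+ 2 ->
  0 < (m11 + w1 ^+ 2) * (m22 + w2 ^+ 2) - (m12 + w1 * w2) ^+ 2.
Proof.
move=> h1 hD; have q0 := quad_form_ge0 w1 w2 h1 hD.
have -> : (m11 + w1 ^+ 2) * (m22 + w2 ^+ 2) - (m12 + w1 * w2) ^+ 2 =
  (m11 * m22 - m12 ^+ 2) +
  (m22 * w1 ^+ 2 - 2 * m12 * w1 * w2 + m11 * w2 ^+ 2) by ring.
by rewrite ltr_wpDr.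
Qed.

Lemma det2_sum_gt0 (R : realType) p (d d' : 'I_p -> R) (m11 m12 m22 : R) :
  0 < m11 -> 0 < m11 * m22 - m12 ^+ 2 ->
  0 < (m11 + \sum_j d j ^+ 2) * (m22 + \sum_j d' j ^+ 2) -
    (m12 + \sum_j d j * d' j) ^+ 2.
Proof.
elim: p d d' m11 m12 m22 => [|p IH] d d' m11 m12 m22 h1 hD.
  by rewrite !big_ord0 !addr0.
rewrite !big_ord_recl !addrA IH//; last exact: det2_gt0.
by rewrite ltr_wpDr// sqr_ge0.
Qed.

Lemma measurable_lin (R : realType) p (d : 'I_p -> R) :
  measurable_fun setT (fun x : p.-tuple R => \sum_j tnth x j * d j).
Proof.
by apply: measurable_sum => j; apply: measurable_funM => //; exact: measurable_tnth.
Qed.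

Lemma integral_iid_gauss2 (R : realType) p (d d' : 'I_p -> R)
    (m11 m12 m22 t1 t2 : R) :
  let n11 := m11 + \sum_j d j ^+ 2 in
  let n12 := m12 + \sum_j d j * d' j in
  let n22 := m22 + \sum_j d' j ^+ 2 in
  0 < m11 -> 0 < m11 * m22 - m12 ^+ 2 ->
  (\int[iid (normal 0 1) p]_x
     (gauss2 m11 m12 m22 (t1 - \sum_j tnth x j * d j)
       (t2 - \sum_j tnth x j * d' j))%:E =
   (Num.sqrt ((m11 * m22 - m12 ^+ 2) / (n11 * n22 - n12 ^+ 2)) *
     gauss2 n11 n12 n22 t1 t2)%:E)%E.
Proof.
move=> n11 n12 n22 h1 hD; rewrite /n11 /n12 /n22 {n11 n12 n22}.
have mg q (w w' : 'I_q -> R) u u' : measurable_fun setT (fun x : q.-tuple R =>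
    (gauss2 m11 m12 m22 (u - \sum_j tnth x j * w j)
       (u' - \sum_j tnth x j * w' j))%:E).
  apply/measurable_EFinP.
  by apply: measurable_gauss2; apply: measurable_funB => //; exact: measurable_lin.
elim: p d d' t1 t2 => [|p IH] d d' t1 t2.
  rewrite !big_ord0 !addr0 divff ?gt_eqF// sqrtr1 mul1r.
  under eq_integral do rewrite !big_ord0 !subr0.
  by rewrite integral_cst//= diracT mule1.
rewrite (integral_iid_cons _ (mg _ d d' t1 t2)); last first.
  by move=> t; rewrite lee_fin expR_ge0.
pose S11 := \sum_(j < p) d (lift ord0 j) ^+ 2.
pose S12 := \sum_(j < p) d (lift ord0 j) * d' (lift ord0 j).
pose S22 := \sum_(j < p) d' (lift ord0 j) ^+ 2.
pose D1 := (m11 + S11) * (m22 + S22) - (m12 + S12) ^+ 2.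
have D10 : 0 < D1 by exact: det2_sum_gt0.
have m1 : 0 < m11 + S11 by rewrite ltr_wpDr// sumr_ge0// => j _; rewrite sqr_ge0.
transitivity (\int[normal 0 1]_g
  ((Num.sqrt ((m11 * m22 - m12 ^+ 2) / D1))%:E *
   (gauss2 (m11 + S11) (m12 + S12) (m22 + S22)
      (t1 - g * d ord0) (t2 - g * d' ord0))%:E))%E.
  apply: eq_integral => g _; rewrite -EFinM.
  rewrite -(IH (fun j => d (lift ord0 j)) (fun j => d' (lift ord0 j))).
  have E x w : \sum_j tnth (pcons (g, x)) j * w j =
      g * w ord0 + \sum_(j < p) tnth x j * w (lift ord0 j).
    rewrite big_ord_recl tnth0; congr (_ + _).
    by apply: eq_bigr => j _; rewrite tnthS.
  by apply: eq_integral => x _; rewrite !E !opprD !addrA.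
rewrite ge0_integralZl_EFin//; last 2 first.
- by move=> x _; rewrite lee_fin expR_ge0.
- apply/measurable_EFinP; apply: measurable_gauss2; apply: measurable_funB => //;
  exact: measurable_funM.
rewrite integral_normal_gauss2// -EFinM; congr EFin.
rewrite mulrA -sqrtrM ?divr_ge0 ?(ltW hD) ?(ltW D10)//.
rewrite !big_ord_recl /= -/S11 -/S12 -/S22.
rewrite [d ord0 ^+ 2 + S11]addrC [d' ord0 ^+ 2 + S22]addrC
  [d ord0 * d' ord0 + S12]addrC !addrA -/D1.
by rewrite mulrA divfK ?gt_eqF.
Qed.

(** * Second moments of likelihood ratios in the linear model *)

(** If A is positive semidefinite with A A = 1, a column v of A - 1 satisfies A v = - v, so v^T A v
    = - v^T v is both nonnegative and nonpositive, and v = 0. *)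
Lemma sqrtmx1 (R : realType) p : sqrtmx (1%:M : 'M[R]_p) = 1%:M.
Proof.
rewrite /sqrtmx; case: xgetP => [A _ [] [At Apsd] AA|]; last first.
  move=> /(_ 1%:M) [].
  split; last by rewrite mul1mx.
  split; first by rewrite trmx1.
  by move=> u; rewrite mulmx1 mxE sumr_ge0// => j _; rewrite mxE -expr2 sqr_ge0.
apply/eqP; rewrite -subr_eq0; apply/eqP/matrixP => i j; rewrite [RHS]mxE.
pose v : 'cV[R]_p := col j (A - 1%:M).
have Av : A *m v = - v.
  by rewrite /v colE mulmxA mulmxBr AA mulmx1 -mulNmx opprB.
have := Apsd v; rewrite -mulmxA Av mulmxN mxE oppr_ge0 => vv.
have : (v^T *m v) 0 0 = 0.
  apply/eqP; rewrite eq_le vv mxE sumr_ge0// => k _.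
  by rewrite mxE -expr2 sqr_ge0.
rewrite mxE => /eqP; rewrite psumr_eq0; last first.
  by move=> k _; rewrite mxE -expr2 sqr_ge0.
move=> /allP /(_ i (mem_index_enum _)); rewrite mxE -expr2 sqrf_eq0.
by rewrite /v mxE => /eqP.
Qed.

Lemma integral_mvnormal1 (R : realType) p (f : p.-tuple R -> \bar R) :
  measurable_fun setT f -> (forall x, 0 <= f x)%E ->
  (\int[mvnormal 1%:M]_x f x = \int[iid (normal 0 1) p]_x f x)%E.
Proof.
move=> mf f0; rewrite /mvnormal ge0_integral_pushforward//= preimage_setT.
apply: eq_integral => x _ /=; congr f; apply: eq_from_tnth => j.
by rewrite tnth_mktuple sqrtmx1 mul1mx mxE.
Qed.

(** One row of the second moment, at fixed noise [e]. Integrating out the row leaves a bivariate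
    Gaussian with sg^2 + r on the diagonal and u off it, whose eigenvalues are sg^2 + r - u and sg^2
    + r + u. It is evaluated at (e, e), an eigenvector for the latter, hence the exponent. The term
    [0 * e] matches [integral_normal_expR]. *)
Lemma integral_row (R : realType) (p : nat) (sg s r u e : R) (d d' : 'cV[R]_p) :
  0 < sg -> 0 < s -> 0 <= u <= r ->
  \sum_j d j 0 ^+ 2 = r -> \sum_j d' j 0 ^+ 2 = r ->
  \sum_j d j 0 * d' j 0 = u ->
  (\int[mvnormal 1%:M]_x
     (lratio sg s (\sum_j tnth x j * d j 0) e *
      lratio sg s (\sum_j tnth x j * d' j 0) e)%:E =
   (s ^+ 2 / Num.sqrt ((sg ^+ 2 + r - u) * (sg ^+ 2 + r + u)) *
      expR (- ((2 / (sg ^+ 2 + r + u) - 2 / s ^+ 2) * e ^+ 2) / 2 + 0 * e))%:E)%E.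
Proof.
move=> sg0 s0 /andP[u0 ur] dr d'r ddu.
have sg20 : 0 < sg ^+ 2 by rewrite exprn_gt0.
have A0 : 0 < sg ^+ 2 + r - u by lra.
have B0 : 0 < sg ^+ 2 + r + u by lra.
rewrite integral_mvnormal1; last 2 first.
- apply/measurable_EFinP.
  by apply: measurable_funM; apply: measurable_lratio => //; exact: measurable_lin.
- by move=> x; rewrite lee_fin mulr_ge0// lratio_ge0// ltW.
transitivity (\int[iid (normal 0 1) p]_x
  (((s / sg) ^+ 2 * expR (e ^+ 2 / s ^+ 2))%:E *
   (gauss2 (sg ^+ 2) 0 (sg ^+ 2) (e - \sum_j tnth x j * d j 0)
    (e - \sum_j tnth x j * d' j 0))%:E))%E.
  apply: eq_integral => x _; rewrite -EFinM /lratio /gauss2.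
  set a := \sum_j _; set b := \sum_j _; congr EFin.
  rewrite [LHS]mulrACA -expRD -expr2 -[RHS]mulrA -expRD; congr (_ * expR _).
  by field; rewrite !gt_eqF.
have D0 : 0 < sg ^+ 2 * sg ^+ 2 - 0 ^+ 2 by rewrite expr0n subr0 mulr_gt0.
rewrite ge0_integralZl_EFin//; last 3 first.
- by move=> x _; rewrite lee_fin expR_ge0.
- apply/measurable_EFinP.
  by apply: measurable_gauss2; apply: measurable_funB => //;
    exact: (measurable_lin (fun j => _ j 0)).
- by rewrite mulr_ge0 ?expR_ge0// sqr_ge0.
rewrite (integral_iid_gauss2 (fun j => d j 0) (fun j => d' j 0))//.
rewrite dr d'r ddu !add0r expr0n subr0 -EFinM; congr EFin.
have DE : (sg ^+ 2 + r) * (sg ^+ 2 + r) - u ^+ 2 =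
  (sg ^+ 2 + r - u) * (sg ^+ 2 + r + u) by ring.
have SE : Num.sqrt (sg ^+ 2 * sg ^+ 2 /
    ((sg ^+ 2 + r - u) * (sg ^+ 2 + r + u))) =
    sg ^+ 2 / Num.sqrt ((sg ^+ 2 + r - u) * (sg ^+ 2 + r + u)).
  rewrite sqrtrM; last by rewrite mulr_ge0// ltW.
  rewrite -expr2 sqrtr_sqr gtr0_norm// sqrtrV//.
  by rewrite mulr_ge0// ltW.
rewrite /gauss2 DE SE.
rewrite mulrACA -expRD; congr (_ * expR _).
  rewrite mulrA; congr (_ / _); field; by rewrite gt_eqF.
field; by rewrite !gt_eqF.
Qed.

Definition lik (R : realType) n p (sg s : R) (d : 'cV[R]_p) (z : data R n p) : R :=
  \prod_(i < n)
    lratio sg s (\sum_j tnth (tnth z.1 i) j * d j 0) (tnth z.2 i).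

Lemma lik_ge0 (R : realType) n p (sg s : R) (d : 'cV[R]_p) (z : data R n p) :
  0 < sg -> 0 < s -> 0 <= lik sg s d z.
Proof. by move=> sg0 s0; apply: prodr_ge0 => i _; rewrite lratio_ge0// ltW. Qed.

Lemma measurable_lik (R : realType) n p (sg s : R) (d : 'cV[R]_p) :
  measurable_fun setT (@lik R n p sg s d).
Proof.
apply: measurable_prod => i _; apply: measurable_lratio.
  apply: (measurableT_comp (measurable_lin (fun j => d j 0))).
  exact: (measurableT_comp (measurable_tnth i)).
exact: (measurableT_comp (measurable_tnth i)).
Qed.

(** The law of design and noise before [observe] is applied, so that one reference measure serves
    every [b]. *)
Definition gaussian (R : realType) n p (s : R) : probability (data R n p) R :=
  (iid (mvnormal 1%:M) n \x iid (normal 0 s) n)%E.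

(** The bound on sg^2 + r + u by 2 s^2 is an integrability condition: it keeps the coefficient of
    e^2 negative once the row integral is weighted by N(0, s^2). *)
Lemma integral_lik2 (R : realType) n p (sg s r u : R) (d d' : 'cV[R]_p) :
  0 < sg -> 0 < s -> 0 <= u <= r -> sg ^+ 2 + r + u < 2 * s ^+ 2 ->
  \sum_j d j 0 ^+ 2 = r -> \sum_j d' j 0 ^+ 2 = r ->
  \sum_j d j 0 * d' j 0 = u ->
  (\int[gaussian n p s]_z (lik sg s d z * lik sg s d' z)%:E =
   ((s ^+ 2 / Num.sqrt ((sg ^+ 2 + r - u) * (2 * s ^+ 2 - sg ^+ 2 - r - u)))
     ^+ n)%:E)%E.
Proof.
move=> sg0 s0 ur rs dr d'r ddu; have /andP[u0 ru] := ur.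
have sg20 : 0 < sg ^+ 2 by rewrite exprn_gt0.
have s20 : 0 < s ^+ 2 by rewrite exprn_gt0.
have A0 : 0 < sg ^+ 2 + r - u by lra.
have B0 : 0 < sg ^+ 2 + r + u by lra.
have C0 : 0 < 2 * s ^+ 2 - sg ^+ 2 - r - u by lra.
rewrite /gaussian fubini_tonelli2/=; last 2 first.
- by apply/measurable_EFinP; apply: measurable_funM; exact: measurable_lik.
- by move=> z; rewrite lee_fin mulr_ge0// lik_ge0.
rewrite /fubini_G.
pose K e := s ^+ 2 / Num.sqrt ((sg ^+ 2 + r - u) * (sg ^+ 2 + r + u)) *
      expR (- ((2 / (sg ^+ 2 + r + u) - 2 / s ^+ 2) * e ^+ 2) / 2 + 0 * e).
have K0 e : 0 <= K e by rewrite mulr_ge0 ?expR_ge0// divr_ge0 ?sqrtr_ge0// ltW.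
transitivity (\int[iid (normal 0 s) n]_e (\prod_(i < n) K (tnth e i))%:E)%E.
  apply: eq_integral => e _.
  pose g (i : 'I_n) (x : p.-tuple R) :=
    lratio sg s (\sum_j tnth x j * d j 0) (tnth e i) *
    lratio sg s (\sum_j tnth x j * d' j 0) (tnth e i).
  transitivity (\int[iid (mvnormal 1%:M) n]_X
      (\prod_(i < n) g i (tnth X i))%:E)%E.
    by apply: eq_integral => X _; rewrite /lik -big_split.
  apply: (integral_iid_prod (g := g) (c := fun i => K (tnth e i))).
  - move=> i; apply: measurable_funM; apply: measurable_lratio => //;
    exact: (measurable_lin (fun j => _ j 0)).
  - by move=> i x; rewrite mulr_ge0// lratio_ge0// ltW.
  - by move=> i; exact: integral_row.
have mE : measurable_fun setT (fun e : R =>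
   expR (- ((2 / (sg ^+ 2 + r + u) - 2 / s ^+ 2) * e ^+ 2) / 2 + 0 * e)).
  apply: measurableT_comp => //.
  apply: measurable_funD; last exact: measurable_funM.
  apply: measurable_funM => //; apply: measurableT_comp => //.
  by apply: measurable_funM => //; exact: measurable_funX.
rewrite (integral_iid_prod (g := fun=> K) (c := fun=>
  s ^+ 2 / Num.sqrt ((sg ^+ 2 + r - u) * (2 * s ^+ 2 - sg ^+ 2 - r - u)))).
- by rewrite prodr_const card_ord.
- by move=> i; exact: measurable_funM.
- by move=> i x; exact: K0.
move=> i; rewrite /K; under eq_integral do rewrite EFinM.
have wE : 1 + (2 / (sg ^+ 2 + r + u) - 2 / s ^+ 2) * s ^+ 2 =
   (2 * s ^+ 2 - sg ^+ 2 - r - u) / (sg ^+ 2 + r + u).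
  by field; rewrite !gt_eqF.
have w0 : 0 < 1 + (2 / (sg ^+ 2 + r + u) - 2 / s ^+ 2) * s ^+ 2.
  by rewrite wE divr_gt0.
rewrite ge0_integralZl_EFin//; last 2 first.
- exact/measurable_EFinP.
- by rewrite divr_ge0 ?sqrtr_ge0// ltW.
rewrite integral_normal_expR// expr0n/= !mul0r expR0 mulr1 wE -EFinM; congr EFin.
rewrite -mulrA -invfM -sqrtrM; last by rewrite mulr_ge0// ltW.
congr (_ / Num.sqrt _); by field; rewrite gt_eqF.
Qed.

Lemma observeD (R : realType) n p (b d : 'cV[R]_p)
    (X : n.-tuple (p.-tuple R)) (e : n.-tuple R) :
  observe (b + d) (X, e) = observe b
    (X, [tuple (\sum_j tnth (tnth X i) j * d j 0) + tnth e i | i < n]).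
Proof.
rewrite /observe /=; congr pair; apply: eq_from_tnth => i.
rewrite !tnth_mktuple addrA mulmxDr mxE; congr (_ + _ + _).
by rewrite mxE; apply: eq_bigr => j _; rewrite mxE.
Qed.

(** Given the design, the shift X d of the mean is absorbed into the noise, so passing from b to b +
    d and from s to sg only changes the density of each noise variable. *)
Lemma law_lik (R : realType) n p (sg s : R) (b d : 'cV[R]_p)
    (B : set (data R n p)) :
  0 < sg -> 0 < s -> measurable B ->
  (law n (Param (b + d) 1%:M sg) B =
   \int[gaussian n p s]_z (\1_B (observe b z) * lik sg s d z)%:E)%E.
Proof.
move=> sg0 s0 mB.
have m1 c : measurable_fun setT
    (fun z : data R n p => (\1_B (observe c z) : R)%:E).
  apply/measurable_EFinP.
  exact: (measurableT_comp (measurable_indic mB) (@measurable_observe R n p c)).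
have mS : measurable (observe (b + d) @^-1` B).
  by rewrite -[X in measurable X]setTI; exact: measurable_observe.
transitivity (\int[gaussian n p sg]_z (\1_B (observe (b + d) z))%:E)%E.
  by rewrite (integral_indic _ measurableT mS) setIT.
have f0 (z : data R n p) : (0 <= (\1_B (observe (b + d) z) : R)%:E)%E.
  by rewrite lee_fin.
have g0 (z : data R n p) :
    (0 <= (\1_B (observe b z) * lik sg s d z)%:E)%E.
  by rewrite lee_fin mulr_ge0// lik_ge0.
have mg : measurable_fun setT
    (fun z : data R n p => (\1_B (observe b z) * lik sg s d z)%:E).
  apply/measurable_EFinP; apply: measurable_funM; last exact: measurable_lik.
  by apply/measurable_EFinP; exact: m1.
apply: (etrans (fubini_tonelli1 (m1 := iid (mvnormal 1%:M) n)
  (m2 := iid (normal 0 sg) n) _ (m1 (b + d)) f0)).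
apply/esym; apply: (etrans (fubini_tonelli1 (m1 := iid (mvnormal 1%:M) n)
  (m2 := iid (normal 0 s) n) _ mg g0)); apply/esym.
apply: eq_integral => X _; rewrite /fubini_F.
pose v i := \sum_j tnth (tnth X i) j * d j 0.
pose f e := ((\1_B (observe b (X, e)) : R)%:E)%E.
have mf : measurable_fun setT f.
  exact: (measurableT_comp (m1 b) (measurable_fun_pair _ _)).
have f'0 e : (0 <= f e)%E by rewrite lee_fin.
apply: (etrans _ (etrans (integral_iid_normal_shift v sg0 s0 mf f'0) _)).
  by apply: eq_integral => e _; rewrite observeD.
by apply: eq_integral => e _; rewrite EFinM.
Qed.

(** * The second-moment test *)

Lemma probability_fin d (T : measurableType d) (R : realType)
    (P : probability T R) A : measurable A -> exists r : R, P A = r%:E.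
Proof.
by move=> mA; exists (fine (P A)); rewrite fineK// fin_num_measure.
Qed.

(* AM-GM in the form [a chi <= a^2 / (3 N) + 3 N chi / 4] for an indicator
   [chi], applied to the sum [a] of the [N] densities. *)
Lemma second_moment_test d d' (T : measurableType d) (T' : measurableType d')
    (R : realType) (P : probability T R) (phi : T -> T') (I : finType)
    (L : I -> T -> R) (Q : I -> probability T' R) (m : I -> I -> R)
    (A : set T') :
  measurable_fun setT phi -> (0 < #|I|)%N ->
  (forall i, measurable_fun setT (L i)) -> (forall i x, 0 <= L i x) ->
  (forall i B, measurable B ->
     Q i B = \int[P]_x (\1_B (phi x) * L i x)%:E)%E ->
  (forall i j, \int[P]_x (L i x * L j x)%:E = (m i j)%:E)%E ->
  \sum_i \sum_j m i j <= 7 / 5 * #|I|%:R ^+ 2 ->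
  measurable A -> ((3 / 8)%:E <= P (phi @^-1` A))%E ->
  exists i, ((1 / 32)%:E <= Q i A)%E.
Proof.
move=> mphi I0 mL L0 QL mE hm mA PA; apply/not_existsP => H.
set N : R := #|I|%:R in hm *.
have N0 : 0 < N by rewrite ltr0n.
have mphiA B : measurable B -> measurable (phi @^-1` B).
  by move=> mB; rewrite -[X in measurable X]setTI; exact: mphi.
pose chi x : R := \1_(~` A) (phi x).
have mchi : measurable_fun setT chi.
  exact: (measurableT_comp (measurable_indic (measurableC mA)) mphi).
have chi0 x : 0 <= chi x by rewrite /chi.
have chi2 x : chi x * chi x = chi x.
  by rewrite /chi indicE; case: (_ \in _); rewrite ?mulr1 ?mulr0.
have mLL i j : measurable_fun setT (fun x => L i x * L j x).
  by apply: measurable_funM.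
have qC i : ((31 / 32)%:E <= Q i (~` A))%E.
  have [q qE] := probability_fin (Q i) mA.
  have : (Q i A < (1 / 32)%:E)%E by rewrite ltNge; apply/negP/(H i).
  rewrite probability_setC// qE -EFinB lee_fin lte_fin; lra.
(* 7/15 is a third of the second-moment bound 7/5, and 5/8 bounds the null probability of the
   complement. Since 7/15 + 15/32 = 449/480 is less than 31/32 = 465/480, this contradicts [qC]. *)
have : (\sum_i Q i (~` A) <= (N * (7 / 15) + 3 / 4 * N * (5 / 8))%:E)%E.
  have -> : (\sum_i Q i (~` A) = \int[P]_x (\sum_i (chi x * L i x)%:E))%E.
    rewrite ge0_integral_sum//.
    - by apply: eq_bigr => i _; rewrite QL//; exact: measurableC.
    - by move=> i; apply/measurable_EFinP; exact: measurable_funM.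
    - by move=> i x _; rewrite lee_fin mulr_ge0.
  apply: (@le_trans _ _ (\int[P]_x (\sum_i \sum_j ((3 * N)^-1 * (L i x * L j x))%:E
      + (3 / 4 * N * chi x)%:E))%E).
    apply: ge0_le_integral => //.
    - by move=> x _; apply: sume_ge0 => i _; rewrite lee_fin mulr_ge0.
    - apply: emeasurable_sum => i; apply/measurable_EFinP; exact: measurable_funM.
    - apply: emeasurable_funD; last first.
        by apply/measurable_EFinP; exact: measurable_funM.
      apply: emeasurable_sum => i; apply: emeasurable_sum => j.
      by apply/measurable_EFinP; exact: measurable_funM.
    move=> x _; rewrite sumEFin; under [X in (_ <= X + _)%E]eq_bigr do rewrite sumEFin.
    rewrite sumEFin -EFinD lee_fin -mulr_sumr; set a := \sum_i L i x.
    have -> : \sum_i \sum_j (3 * N)^-1 * (L i x * L j x) = (3 * N)^-1 * (a * a).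
      rewrite {1}/a mulr_suml mulr_sumr; apply: eq_bigr => i _.
      by rewrite -!mulr_sumr.
    have -> : (3 * N)^-1 * (a * a) + 3 / 4 * N * chi x =
      chi x * a + (a - 3 / 2 * N * chi x) ^+ 2 / (3 * N).
      by rewrite -{1}chi2; field; rewrite gt_eqF.
    by rewrite lerDl divr_ge0 ?sqr_ge0// mulr_ge0// ltW.
  rewrite ge0_integralD//; last 4 first.
  - move=> x _; apply: sume_ge0 => i _; apply: sume_ge0 => j _.
    by rewrite lee_fin !mulr_ge0// invr_ge0 mulr_ge0// ltW.
  - apply: emeasurable_sum => i; apply: emeasurable_sum => j.
    by apply/measurable_EFinP; exact: measurable_funM.
  - by move=> x _; rewrite lee_fin !mulr_ge0// ltW.
  - by apply/measurable_EFinP; exact: measurable_funM.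
  rewrite EFinD; apply: leeD.
    rewrite ge0_integral_sum//; last 2 first.
    - move=> i; apply: emeasurable_sum => j.
      by apply/measurable_EFinP; exact: measurable_funM.
    - move=> i x _; apply: sume_ge0 => j _.
      by rewrite lee_fin !mulr_ge0// invr_ge0 mulr_ge0// ltW.
    under eq_bigr => i _.
      rewrite ge0_integral_sum//; last 2 first.
      - by move=> j; apply/measurable_EFinP; exact: measurable_funM.
      - by move=> j x _; rewrite lee_fin !mulr_ge0// invr_ge0 mulr_ge0// ltW.
      under eq_bigr => j _.
        under eq_integral do rewrite EFinM.
        rewrite ge0_integralZl_EFin ?mE ?invr_ge0 ?mulr_ge0 ?(ltW N0)//; last 2 first.
        - by move=> x _; rewrite lee_fin mulr_ge0.
        - exact/measurable_EFinP.
        rewrite -EFinM.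
        over.
      rewrite sumEFin -mulr_sumr.
      over.
    rewrite sumEFin -mulr_sumr lee_fin invfM -mulrA -ler_pdivlMl ?invr_gt0//.
    by rewrite invrK ler_pdivrMl// (le_trans hm)//; lra.
  under eq_integral do rewrite EFinM.
  rewrite ge0_integralZl_EFin ?mulr_ge0 ?(ltW N0)//; last 2 first.
  - by move=> x _; rewrite lee_fin.
  - exact/measurable_EFinP.
  rewrite [leRHS]EFinM lee_pmul2l ?lte_fin ?mulr_gt0//.
  have -> : (\int[P]_x (chi x)%:E = P (phi @^-1` (~` A)))%E.
    by rewrite (integral_indic _ measurableT (mphiA _ (measurableC mA))) setIT.
  rewrite preimage_setC probability_setC; last exact: mphiA.
  have [q qE] := probability_fin P (mphiA _ mA).
  by move: PA; rewrite qE -EFinB !lee_fin; lra.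
apply/negP; rewrite -ltNge.
apply: (@lt_le_trans _ _ (\sum_(i : I) (31 / 32)%:E)%E); last exact: lee_sum.
rewrite sumEFin lte_fin sumr_const -[_ *+ _]mulr_natr -/N; nra.
Qed.

(** * The q-norm and the loss *)

Lemma lqnorm_ge0 (R : realType) p (q : R) (x : 'cV[R]_p) : 0 <= lqnorm q x.
Proof. exact: powR_ge0. Qed.

Lemma lqnorm_powR (R : realType) p (q : R) (x : 'cV[R]_p) : 0 < q ->
  lqnorm q x `^ q = \sum_j `|x j 0| `^ q.
Proof.
move=> q0; rewrite /lqnorm -powRrM mulVf ?gt_eqF// powRr1//.
by apply: sumr_ge0 => j _; exact: powR_ge0.
Qed.

Lemma lqnorm_eq0 (R : realType) p (q : R) (x : 'cV[R]_p) : 0 < q ->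
  lqnorm q x = 0 -> x = 0.
Proof.
move=> q0 x0; have := lqnorm_powR x q0; rewrite x0 powR0 ?gt_eqF// => /esym/eqP.
rewrite psumr_eq0; last by move=> j _; exact: powR_ge0.
move=> /allP H; apply/colP => j; rewrite mxE.
have /eqP := H j (mem_index_enum _).
by move=> /powR_eq0_eq0/eqP; rewrite normr_eq0 => /eqP.
Qed.

Lemma lqnormN (R : realType) p (q : R) (x : 'cV[R]_p) : lqnorm q (- x) = lqnorm q x.
Proof. by congr powR; apply: eq_bigr => j _; rewrite mxE normrN. Qed.

Lemma powR_convex2 (R : realType) (q t x y : R) : 1 <= q -> 0 <= t <= 1 ->
  0 <= x -> 0 <= y ->
  (t * x + (1 - t) * y) `^ q <= t * x `^ q + (1 - t) * y `^ q.
Proof.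
move=> q1 /andP[t0 t1] x0 y0.
have := @convex_powR R q q1 (Itv01 t0 t1) x y.
by rewrite !convRE/=; apply; rewrite inE/= in_itv/= andbT.
Qed.

(** Minkowski's inequality: convexity of z^q is applied coordinatewise to x / |x| and y / |y| with
    weights proportional to |x| and |y|. *)
Lemma lqnorm_triangle (R : realType) p (q : R) (x y : 'cV[R]_p) : 1 <= q ->
  lqnorm q (x + y) <= lqnorm q x + lqnorm q y.
Proof.
move=> q1; have q0 : 0 < q by rewrite (lt_le_trans _ q1).
have [/(lqnorm_eq0 q0) ->|an0] := eqVneq (lqnorm q x) 0.
  by rewrite add0r lerDr lqnorm_ge0.
have [/(lqnorm_eq0 q0) ->|bn0] := eqVneq (lqnorm q y) 0.
  by rewrite addr0 lerDl lqnorm_ge0.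
have : 0 < lqnorm q x by rewrite lt_def an0 lqnorm_ge0.
have : 0 < lqnorm q y by rewrite lt_def bn0 lqnorm_ge0.
have := lqnorm_powR x q0; have := lqnorm_powR y q0.
move: (lqnorm q x) (lqnorm q y) => a b Sb Sa b0 a0 {an0 bn0}.
have ab0 : 0 < a + b by rewrite addr_gt0.
have -> : a + b = ((a + b) `^ q) `^ q^-1.
  by rewrite -powRrM mulfV ?gt_eqF// powRr1// ltW.
apply: ge0_ler_powR; rewrite ?invr_ge0 ?(ltW q0) ?nnegrE ?powR_ge0//.
  by apply: sumr_ge0 => j _; exact: powR_ge0.
pose t := a / (a + b).
have t01 : 0 <= t <= 1.
  apply/andP; split; first by rewrite divr_ge0// ltW.
  by rewrite ler_pdivrMr// mul1r lerDl ltW.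
have tC : 1 - t = b / (a + b) by rewrite /t; field; rewrite gt_eqF.
apply: (@le_trans _ _ (\sum_j (a + b) `^ q *
   (t * (`|x j 0| `^ q / a `^ q) + (1 - t) * (`|y j 0| `^ q / b `^ q)))).
  apply: ler_sum => j _.
  have E c z : 0 < c -> 0 <= z -> z `^ q / c `^ q = (z / c) `^ q.
    move=> c0 z0; rewrite powRM//; last by rewrite invr_ge0 ltW.
    by rewrite -(powR_inv1 (ltW c0)) -powRrM mulN1r powRN.
  rewrite !E//.
  have := powR_convex2 q1 t01 (divr_ge0 (normr_ge0 (x j 0)) (ltW a0))
    (divr_ge0 (normr_ge0 (y j 0)) (ltW b0)).
  move=> /(ler_wpM2l (powR_ge0 (a + b) q)); apply: le_trans.
  rewrite tC /t -powRM ?(ltW ab0)//; last first.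
    by rewrite addr_ge0// mulr_ge0// divr_ge0// ltW.
  apply: ge0_ler_powR; rewrite ?(ltW q0) ?nnegrE//.
    by rewrite mulr_ge0 ?(ltW ab0)// addr_ge0// mulr_ge0// divr_ge0// ltW.
  have -> : (a + b) * (a / (a + b) * (`|x j 0| / a) + b / (a + b) * (`|y j 0| / b)) =
    `|x j 0| + `|y j 0| by field; rewrite !gt_eqF.
  by rewrite mxE ler_normD.
rewrite -mulr_sumr big_split/= -!mulr_sumr -!mulr_suml -Sa -Sb.
by rewrite !divff ?gt_eqF ?powR_gt0// !mulr1 addrC subrK mulr1.
Qed.

Lemma measurable_loss (R : realType) n p (q : R)
    (bhat : {mfun data R n p >-> p.-tuple R}) (b : 'cV[R]_p) :
  measurable_fun setT (loss q bhat b).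
Proof.
apply: measurable_funX.
apply: (measurableT_comp (measurable_powR q^-1)).
apply: measurable_sum => j.
apply: (measurableT_comp (measurable_powR q)).
apply: measurableT_comp => //.
rewrite (_ : (fun _ => _) = fun z => tnth (bhat z) j - b j 0); last first.
  by apply/funext => z; rewrite !mxE.
apply: measurable_funB => //.
exact: (measurableT_comp (measurable_tnth j)).
Qed.

(** * Spikes and the block prior *)

Definition spike (R : realType) p (rho : R) (S : {set 'I_p}) : 'cV[R]_p :=
  \col_j (if j \in S then rho else 0).

Lemma l0norm_spike (R : realType) p (b : 'cV[R]_p) (rho : R) (S : {set 'I_p}) :
  (l0norm (b + spike rho S) <= l0norm b + #|S|)%N.
Proof.
rewrite /l0norm; apply: (leq_trans _ (leq_card_setU _ _)); apply: subset_leq_card.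
apply/fintype.subsetP => j; rewrite !inE !mxE; case: (j \in S); rewrite ?orbT//.
by rewrite addr0 orbF.
Qed.

Lemma lqnorm_spike (R : realType) p (q rho : R) (S : {set 'I_p}) :
  0 < q -> 0 <= rho -> lqnorm q (spike rho S) = #|S|%:R `^ q^-1 * rho.
Proof.
move=> q0 rho0; rewrite /lqnorm (bigID (mem S))/= [X in _ + X]big1 ?addr0; last first.
  by move=> j jS; rewrite mxE (negbTE jS) normr0 powR0 ?gt_eqF.
rewrite (eq_bigr (fun=> rho `^ q)); last first.
  by move=> j jS; rewrite mxE jS ger0_norm.
rewrite sumr_const -[X in X `^ _]mulr_natl powRM ?powR_ge0//.
by rewrite -powRrM mulfV ?gt_eqF// powRr1.
Qed.

Lemma dot_spike (R : realType) p (rho : R) (S S' : {set 'I_p}) :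
  \sum_j spike rho S j 0 * spike rho S' j 0 = #|S :&: S'|%:R * rho ^+ 2.
Proof.
rewrite (bigID (mem (S :&: S')))/= [X in _ + X]big1 ?addr0; last first.
  move=> j; rewrite !inE !mxE.
  by case: (j \in S); case: (j \in S') => //=; rewrite ?mulr0 ?mul0r.
rewrite (eq_bigr (fun=> rho ^+ 2)).
  by rewrite sumr_const mulr_natl.
by move=> j; rewrite !inE !mxE => /andP[-> ->].
Qed.

(** Block i consists of the indices i * m + j with j < m, and f selects one of them in each block;
    two selections can meet only inside a common block. *)
Lemma block_design k m p : (k * m <= p)%N ->
  exists S : {ffun 'I_k -> 'I_m} -> {set 'I_p},
    (forall f, #|S f| = k) /\
    (forall f g, #|S f :&: S g| = #|[set i | f i == g i]%SET|).
Proof.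
move=> kmp.
have lt_block (i : 'I_k) (j : 'I_m) : (i * m + j < p)%N.
  apply: leq_trans kmp; apply: (@leq_trans (i.+1 * m)); last by rewrite leq_mul2r ltn_ord orbT.
  by rewrite mulSn addnC ltn_add2r.
pose pt i j := Ordinal (lt_block i j).
have pt_inj i j i' j' : pt i j = pt i' j' -> i = i' /\ j = j'.
  move=> /(congr1 val)/= E; have m0 : (0 < m)%N := leq_ltn_trans (leq0n j) (ltn_ord j).
  have Ei : i = i' :> nat.
    have := congr1 (divn^~ m) E; rewrite !divnMDl// !divn_small//.
    by rewrite !addn0.
  have Ej : j = j' :> nat.
    have := congr1 (modn^~ m) E; rewrite !modnMDl !modn_small//.
  by split; apply: val_inj.
exists (fun f => [set pt i (f i) | i : 'I_k]%SET); split=> [f|f g].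
  rewrite card_imset ?card_ord// => i i'; by move=> /pt_inj[].
rewrite -(card_imset (f := fun i => pt i (f i))); last by move=> i i' /pt_inj[].
congr #|pred_of_set _|; apply/setP => x; rewrite inE; apply/andP/imsetP.
  move=> [/imsetP[i _ ->] /imsetP[i' _]] /pt_inj [ii' fg].
  by exists i => //; rewrite inE fg -ii'.
move=> [i]; rewrite inE => /eqP fg ->; split; apply/imsetP; exists i => //.
by rewrite fg.
Qed.

(** The sum factors over the blocks, each with m - 1 values that miss [g i] and one that hits it. *)
Lemma sum_expR_match (R : realType) k m (t : R) (g : {ffun 'I_k -> 'I_m}) :
  \sum_(f : {ffun 'I_k -> 'I_m}) expR (t * #|[set i | f i == g i]%SET|%:R) =
  (m%:R - 1 + expR t) ^+ k.
Proof.
transitivity (\sum_(f : {ffun 'I_k -> 'I_m}) \prod_i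
    (if f i == g i then expR t else 1)).
  apply: eq_bigr => f _; rewrite -big_mkcond/= prodr_const.
  rewrite mulr_natr -expRM_natl mulr_natl; congr (expR (_ *+ _)).
  by apply: eq_card => i; rewrite !inE.
rewrite -(bigA_distr_bigA (fun i j => if j == g i then expR t else 1)).
rewrite (eq_bigr (fun=> m%:R - 1 + expR t)); first by rewrite prodr_const card_ord.
move=> i _; rewrite (bigD1 (g i))//= eqxx addrC; congr (_ + _).
rewrite (eq_bigr (fun=> 1)); last by move=> j /negbTE ->.
rewrite sumr_const; have := cardC1 (g i); rewrite card_ord => E.
have m0 : (0 < m)%N := leq_ltn_trans (leq0n (g i)) (ltn_ord (g i)).
rewrite (_ : #|_| = m.-1); first by rewrite -subn1 natrB.
by rewrite -E; apply: eq_card => j; rewrite !inE.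
Qed.

Lemma expR_le_inv (R : realType) (x : R) : x < 1 -> expR x <= (1 - x)^-1.
Proof.
move=> x1; rewrite -[expR x]invrK -expRN lef_pV2 ?posrE ?expR_gt0 ?subr_gt0//.
exact: expR_ge1Dx.
Qed.

(** The average of exp(t J + w) over pairs is at most exp(w + k e^t / m). The bound 2/7 is what
    gives 7/5 in the second-moment test, by e^(2/7) <= 1 / (1 - 2/7). *)
Lemma prior_detect (R : realType) n p (sg s rho t w : R) (b : 'cV[R]_p) k m
    (A : set (data R n p)) :
  0 < sg -> 0 < s -> (k * m <= p)%N -> (0 < m)%N ->
  sg ^+ 2 + 2 * (k%:R * rho ^+ 2) < 2 * s ^+ 2 ->
  (forall J : nat, (J <= k)%N ->
     (s ^+ 2 / Num.sqrt ((sg ^+ 2 + k%:R * rho ^+ 2 - J%:R * rho ^+ 2) *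
        (2 * s ^+ 2 - sg ^+ 2 - k%:R * rho ^+ 2 - J%:R * rho ^+ 2))) ^+ n <=
     expR (t * J%:R + w)) ->
  w + k%:R * (expR t / m%:R) <= 2 / 7 ->
  measurable A -> ((3 / 8)%:E <= law n (Param b 1%:M s) A)%E ->
  exists2 S : {set 'I_p}, #|S| = k &
    ((1 / 32)%:E <= law n (Param (b + spike rho S) 1%:M sg) A)%E.
Proof.
move=> sg0 s0 kmp m0 rs mom small mA PA.
have [S [cardS cardI]] := block_design kmp.
have mR0 : 0 < m%:R :> R by rewrite ltr0n.
pose J (f g : {ffun 'I_k -> 'I_m}) := #|[set i | f i == g i]%SET|.
pose mm (f g : {ffun 'I_k -> 'I_m}) :=
  (s ^+ 2 / Num.sqrt ((sg ^+ 2 + k%:R * rho ^+ 2 - (J f g)%:R * rho ^+ 2) *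
     (2 * s ^+ 2 - sg ^+ 2 - k%:R * rho ^+ 2 - (J f g)%:R * rho ^+ 2))) ^+ n.
have Jk f g : (J f g <= k)%N.
  by rewrite /J -[X in (_ <= X)%N]card_ord max_card.
have [] := @second_moment_test _ _ _ _ R (gaussian n p s) (observe b)
  {ffun 'I_k -> 'I_m} (fun f => lik sg s (spike rho (S f)))
  (fun f => law n (Param (b + spike rho (S f)) 1%:M sg)) mm A.
- exact: measurable_observe.
- by rewrite card_ffun !card_ord expn_gt0 m0.
- by move=> f; exact: measurable_lik.
- by move=> f z; exact: lik_ge0.
- by move=> f B mB; exact: law_lik.
- move=> f g; apply: integral_lik2 => //.
  + by rewrite mulr_ge0 ?sqr_ge0//= ler_wpM2r ?sqr_ge0// ler_nat.
  + have : (J f g)%:R * rho ^+ 2 <= k%:R * rho ^+ 2.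
      by rewrite ler_wpM2r ?sqr_ge0// ler_nat.
    lra.
  + by under eq_bigr do rewrite expr2; rewrite dot_spike finset.setIid cardS.
  + by under eq_bigr do rewrite expr2; rewrite dot_spike finset.setIid cardS.
  + by rewrite dot_spike cardI.
- apply: (@le_trans _ _ (\sum_(g : {ffun 'I_k -> 'I_m})
      \sum_(f : {ffun 'I_k -> 'I_m}) expR w * expR (t * (J f g)%:R))).
    rewrite exchange_big; apply: ler_sum => g _; apply: ler_sum => f _.
    by rewrite -expRD addrC; exact: mom.
  under eq_bigr => g _ do rewrite -mulr_sumr sum_expR_match.
  rewrite sumr_const card_ffun !card_ord natrX -[leLHS]mulr_natr natrX.
  have H : (m%:R - 1 + expR t) ^+ k <= m%:R ^+ k * expR (k%:R * (expR t / m%:R)).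
    rewrite expRM_natl -exprMn lerXn2r ?nnegrE ?mulr_ge0 ?expR_ge0 ?ler0n//.
      by rewrite addr_ge0 ?expR_ge0// subr_ge0 ler1n.
    apply: (@le_trans _ _ (m%:R * (1 + expR t / m%:R))).
      have -> : m%:R * (1 + expR t / m%:R) = m%:R + expR t.
        by field; rewrite gt_eqF.
      by rewrite lerD2r gerBl ler01.
    by rewrite ler_wpM2l ?ler0n// expR_ge1Dx.
  apply: (@le_trans _ _ (expR w * (m%:R ^+ k * expR (k%:R * (expR t / m%:R))) * m%:R ^+ k)).
    by rewrite ler_wpM2r ?exprn_ge0 ?ler0n// ler_wpM2l ?expR_ge0.
  have -> : expR w * (m%:R ^+ k * expR (k%:R * (expR t / m%:R))) * m%:R ^+ k =
    expR (w + k%:R * (expR t / m%:R)) * (m%:R ^+ k) ^+ 2 by rewrite expRD; ring.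
  rewrite ler_wpM2r ?sqr_ge0//.
  apply: (@le_trans _ _ (expR (2 / 7))); first by rewrite ler_expR.
  have h : (2 / 7 : R) < 1 by lra.
  apply: (le_trans (expR_le_inv h)).
  by have -> : (1 - 2 / 7 : R)^-1 = 7 / 5 by field.
- exact: mA.
- exact: PA.
by move=> f Hf; exists (S f).
Qed.

(** * From undetectable families to the risk *)

Lemma two_prior_risk (R : realType) n p k (q sg s a rho1 rho2 rate : R)
    k1 k2 (b : 'cV[R]_p) (bhat : {mfun data R n p >-> p.-tuple R}) :
  1 <= q -> 0 < sg -> 0 <= rho1 -> 0 <= rho2 -> 0 <= a ->
  (l0norm b + k1 <= k)%N -> (l0norm b + k2 <= k)%N ->
  (law n (Param b 1%:M s) [set z | (loss q bhat b z > a)%R] <= (1 / 4)%:E)%E ->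
  (forall A, measurable A -> ((3 / 8)%:E <= law n (Param b 1%:M s) A)%E ->
    exists2 S : {set 'I_p}, #|S| = k1 &
      ((1 / 32)%:E <= law n (Param (b + spike rho1 S) 1%:M sg) A)%E) ->
  (forall A, measurable A -> ((3 / 8)%:E <= law n (Param b 1%:M s) A)%E ->
    exists2 S : {set 'I_p}, #|S| = k2 &
      ((1 / 32)%:E <= law n (Param (b + spike rho2 S) 1%:M sg) A)%E) ->
  Num.sqrt a <= k1%:R `^ q^-1 * rho1 ->
  (k2%:R `^ q^-1 * rho2 + Num.sqrt a) ^+ 2 + 2 * rate <=
    (k1%:R `^ q^-1 * rho1 - Num.sqrt a) ^+ 2 ->
  ((1 / 32)%:E <= minimax_risk q sg k bhat rate)%E.
Proof.
move=> q1 sg0 rho10 rho20 a0 k1k k2k good D1 D2 ha hsep.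
have q0 : 0 < q by rewrite (lt_le_trans _ q1).
apply/ereal_infP => _ [L _ <-].
set X := k1%:R `^ q^-1 * rho1 - Num.sqrt a in hsep.
set Y := k2%:R `^ q^-1 * rho2 + Num.sqrt a in hsep.
have X0 : 0 <= X by rewrite subr_ge0.
have Y0 : 0 <= Y by rewrite addr_ge0 ?sqrtr_ge0// mulr_ge0// powR_ge0.
have bad_meas theta : measurable
    [set z | rate <= `|L z - loss q bhat (beta theta) z|].
  have mf : measurable_fun setT (fun z => `|L z - loss q bhat (beta theta) z|).
    by apply: measurableT_comp => //; apply: measurable_funB => //; exact: measurable_loss.
  rewrite -[X in measurable X]setTI.
  rewrite (_ : [set z | _] = (fun z => `|L z - loss q bhat (beta theta) z|) @^-1` `[rate, +oo[%classic).
    exact: mf.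
  by apply/seteqP; split => z /=; rewrite in_itv/= andbT.
have conclude k' rho (A : set (data R n p)) (S : {set 'I_p}) : (l0norm b + k' <= k)%N ->
    #|S| = k' -> measurable A ->
    ((1 / 32)%:E <= law n (Param (b + spike rho S) 1%:M sg) A)%E ->
    (forall z, A z -> rate <= `|L z - loss q bhat (b + spike rho S) z|) ->
    ((1 / 32)%:E <= ereal_sup [set law n theta
        [set z | (rate <= `|L z - loss q bhat (beta theta) z|)%R]
      | theta in Theta0 sg k])%E.
  move=> k'k cS mA lA bad.
  pose theta := Param (b + spike rho S) 1%:M sg.
  apply: le_ereal_sup_tmp; exists (law n theta
        [set z | (rate <= `|L z - loss q bhat (beta theta) z|)%R]).
    exists theta => //; split => //=.
    by rewrite (leq_trans (l0norm_spike _ _ _))// cS.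
  apply: (le_trans lA); apply: le_measure; rewrite ?inE//; exact: bad_meas.
pose G := [set z | loss q bhat b z <= a].
(* On [G] the loss is at least X^2 along the first family and at most Y^2 along the second, so on
   either side of the midpoint [L] errs by at least (X^2 - Y^2) / 2 for one of them. As [G] has null
   probability at least 3/4, one side keeps 3/8. *)
pose mid := (X ^+ 2 + Y ^+ 2) / 2.
pose E := [set z | mid <= L z].
have mG : measurable G.
  rewrite -[X in measurable X]setTI.
  rewrite (_ : G = loss q bhat b @^-1` `]-oo, a]%classic); first exact: measurable_loss.
  by apply/seteqP; split => z /=; rewrite in_itv.
have mE : measurable E.
  rewrite -[X in measurable X]setTI.
  rewrite (_ : E = L @^-1` `[mid, +oo[%classic); first exact: measurable_funP.
  by apply/seteqP; split => z /=; rewrite in_itv/= andbT.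
have PG : ((3 / 4)%:E <= law n (Param b 1%:M s) G)%E.
  have -> : G = ~` [set z | (loss q bhat b z > a)%R].
    by rewrite /G; apply/seteqP; split => z /=; rewrite leNgt => /negP.
  have mGC : measurable [set z | (loss q bhat b z > a)%R].
    rewrite (_ : [set z | _] = ~` G); first exact: measurableC.
    by rewrite /G; apply/seteqP; split => z /=; rewrite ltNge => /negP.
  rewrite probability_setC//.
  have [r rE] := probability_fin (law n (Param b 1%:M s)) mGC.
  by move: good; rewrite rE -EFinB !lee_fin; lra.
have near_b z : G z -> lqnorm q (col_of_tuple (bhat z) - b) <= Num.sqrt a.
  rewrite /G /= /loss => Gz.
  by rewrite -[leLHS]ger0_norm ?lqnorm_ge0// -sqrtr_sqr ler_wsqrtr.
have [PE|PE] := leP (3 / 8)%:E (law n (Param b 1%:M s) (G `&` E)).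
  have [S cS lS] := D2 _ (measurableI _ _ mG mE) PE.
  apply: (conclude k2 rho2 (G `&` E) S) => //; first exact: measurableI.
  move=> z [Gz Ez]; have lz : loss q bhat (b + spike rho2 S) z <= Y ^+ 2.
    rewrite /loss lerXn2r ?nnegrE ?lqnorm_ge0//.
    rewrite opprD addrA (le_trans (lqnorm_triangle _ _ q1))// lqnormN.
    by rewrite lqnorm_spike// cS [leLHS]addrC /Y lerD2l near_b.
  by rewrite (le_trans _ (ler_norm _))//; move: Ez; rewrite /E/=/mid; lra.
have PE' : ((3 / 8)%:E <= law n (Param b 1%:M s) (G `&` ~` E))%E.
  have mGE := measurableI _ _ mG mE.
  have mGE' := measurableI _ _ mG (measurableC mE).
  have : law n (Param b 1%:M s) G = (law n (Param b 1%:M s) (G `&` E) +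
      law n (Param b 1%:M s) (G `&` ~` E))%E.
    rewrite -measureU//; first by rewrite -setIUr setUCr setIT.
    by rewrite setIACA setICr setI0.
  have [x xE] := probability_fin (law n (Param b 1%:M s)) mGE.
  have [y yE] := probability_fin (law n (Param b 1%:M s)) mGE'.
  move: PG PE => + + GE; rewrite GE xE yE.
  by rewrite -EFinD !lee_fin lte_fin; lra.
have [S cS lS] := D1 _ (measurableI _ _ mG (measurableC mE)) PE'.
apply: (conclude k1 rho1 (G `&` ~` E) S) => //.
  exact: measurableI _ _ mG (measurableC mE).
move=> z [Gz /negP]; rewrite -ltNge /mid => Ez.
have lz : X ^+ 2 <= loss q bhat (b + spike rho1 S) z.
  rewrite /loss lerXn2r ?nnegrE ?lqnorm_ge0//.
  rewrite /X -cS -lqnorm_spike// lerBlDr.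
  have vE (u v w : 'cV[R]_p) : w = (u - v) - (u - (v + w)).
    by apply/colP => j; rewrite !mxE; ring.
  rewrite {1}(vE (col_of_tuple (bhat z)) b (spike rho1 S)).
  apply: (le_trans (lqnorm_triangle _ _ q1)).
  rewrite (lqnormN q (col_of_tuple (bhat z) - (b + spike rho1 S))) [leRHS]addrC.
  by apply: lerD => //; exact: near_b.
rewrite distrC (le_trans _ (ler_norm _))//; lra.
Qed.

(** * Undetectability of spikes of order log p / n *)

(** With 324 = 18^2, the hypotheses give 324 k^2 e^t <= p, and p <= 2 k m for m = p %/ k. The bound
    1/28 is what remains of the 2/7 in [prior_detect] after w <= 1/4. *)
Lemma match_small (R : realType) (p k : nat) (g t : R) :
  (0 < k)%N -> 18 * k%:R <= p%:R `^ g -> g < 1 / 2 ->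
  0 <= t <= (1 - 2 * g) * ln p%:R ->
  (0 < p %/ k)%N /\ k%:R * (expR t / (p %/ k)%:R) <= 1 / 28.
Proof.
move=> k0 kp g2 /andP[t0 tp].
have kR1 : 1 <= k%:R :> R by rewrite ler1n.
have p0 : (0 < p)%N.
  (* For g = 0 the power of 0 is 1 by convention, which is still below 18 k. *)
  rewrite lt0n; apply/eqP => p0; move: kp; rewrite p0.
  by have [->|gn0] := eqVneq g 0; [rewrite powRr0; lra | rewrite powR0//; lra].
have pR0 : 0 < p%:R :> R by rewrite ltr0n.
have pg : p%:R `^ g = expR (g * ln p%:R) by rewrite /powR gt_eqF.
rewrite pg in kp.
have H : 324 * k%:R ^+ 2 * expR t <= p%:R.
  apply: (@le_trans _ _ (expR (g * ln p%:R) ^+ 2 * expR ((1 - 2 * g) * ln p%:R))).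
    apply: ler_pM; rewrite ?expR_ge0 ?ler_expR//; last by nra.
  rewrite -expRM_natl -expRD -[leRHS]lnK ?posrE// ler_expR.
  by rewrite le_eqVlt; apply/orP; left; apply/eqP; ring.
have et : 1 <= expR t by rewrite -expR0 ler_expR.
have kp' : (k <= p)%N by rewrite -(ler_nat R); nra.
have m0 : (0 < p %/ k)%N by rewrite divn_gt0.
split => //.
have pm : p%:R <= 2 * k%:R * (p %/ k)%:R :> R.
  rewrite -!natrM ler_nat; have := ltn_ceil p k0; nia.
have mR0 : 0 < (p %/ k)%:R :> R by rewrite ltr0n.
rewrite mulrA ler_pdivrMr//; nra.
Qed.

(* The choice s = sg, for which the variance of y increases from b to the
   alternatives b + spike rho S. *)
Lemma detect_known (R : realType) n p (sg x g : R) (b : 'cV[R]_p) k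
    (A : set (data R n p)) :
  0 < sg -> (0 < k)%N -> 18 * k%:R <= p%:R `^ g -> g < 1 / 2 -> 0 <= x ->
  9 / 8 * n%:R * x <= (1 - 2 * g) * ln p%:R ->
  k%:R * x <= 1 / 27 -> n%:R * (k%:R * x) ^+ 2 <= 4 / 9 ->
  measurable A -> ((3 / 8)%:E <= law n (Param b 1%:M sg) A)%E ->
  exists2 S : {set 'I_p}, #|S| = k &
    ((1 / 32)%:E <= law n (Param (b + spike (sg * Num.sqrt x) S) 1%:M sg) A)%E.
Proof.
move=> sg0 k0 kp g2 x0 tx kx nkx mA PA.
have t0 : 0 <= 9 / 8 * n%:R * x by rewrite !mulr_ge0.
have [m0 sm] := match_small k0 kp g2 (introT andP (conj t0 tx)).
have rhoE : (sg * Num.sqrt x) ^+ 2 = sg ^+ 2 * x.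
  by rewrite exprMn sqr_sqrtr.
have sg20 : 0 < sg ^+ 2 by rewrite exprn_gt0.
(* With r = k x and u = J x, one observation contributes (1 - (2 u + r^2) + u^2)^(-1/2). As 1 / (1 -
   z) <= 1 + 9 z / 8 for 0 <= z <= 1/9, it is at most exp(9/16 (2 u + r^2)); the u part gives t and
   the r^2 part, due to the unmatched variance, gives w. The bound r <= 1/27 ensures z <= 1/9. *)
apply: (@prior_detect R n p sg sg (sg * Num.sqrt x) (9 / 8 * n%:R * x)
  (9 / 16 * (n%:R * (k%:R * x) ^+ 2)) b k (p %/ k) A) => //.
- by rewrite mulnC leq_trunc_div.
- by rewrite rhoE; nra.
- move=> J Jk; rewrite rhoE.
  set r := k%:R * x in kx nkx *.
  set u := J%:R * x.
  have ur : 0 <= u <= r by rewrite mulr_ge0//= ler_wpM2r// ler_nat.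
  have -> : (sg ^+ 2 + k%:R * (sg ^+ 2 * x) - J%:R * (sg ^+ 2 * x)) *
     (2 * sg ^+ 2 - sg ^+ 2 - k%:R * (sg ^+ 2 * x) - J%:R * (sg ^+ 2 * x)) =
    (sg ^+ 2) ^+ 2 * ((1 + r - u) * (1 - r - u)) by rewrite /r /u; ring.
  move/andP: ur => [u0 ur].
  have y0 : 0 < (1 + r - u) * (1 - r - u) by apply: mulr_gt0; lra.
  rewrite sqrtrM ?sqr_ge0// sqrtr_sqr gtr0_norm// invfM mulrA divff ?gt_eqF// mul1r.
  have -> : 9 / 8 * n%:R * x * J%:R + 9 / 16 * (n%:R * r ^+ 2) =
    n%:R * (9 / 16 * (2 * u + r ^+ 2)) by rewrite /u; field.
  rewrite expRM_natl lerXn2r ?nnegrE ?invr_ge0 ?sqrtr_ge0 ?expR_ge0//.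
  rewrite -[leRHS]invrK -expRN lef_pV2 ?posrE ?sqrtr_gt0 ?expR_gt0//.
  rewrite -(@ler_pXn2r _ 2) ?nnegrE ?sqrtr_ge0 ?expR_ge0// sqr_sqrtr; last exact: ltW.
  rewrite -expRM_natl.
  have -> : 2 * - (9 / 16 * (2 * u + r ^+ 2)) = - (9 / 8 * (2 * u + r ^+ 2)) :> R.
    by field.
  set v := 9 / 8 * (2 * u + r ^+ 2).
  have v0 : 0 <= v by rewrite /v; nra.
  apply: (@le_trans _ _ (1 + v)^-1).
    by rewrite expRN lef_pV2 ?posrE ?expR_gt0 ?expR_ge1Dx//; lra.
  rewrite -[leLHS]mul1r ler_pdivrMr; last by lra.
  have yE : (1 + r - u) * (1 - r - u) = 1 - (2 * u + r ^+ 2) + u ^+ 2 by ring.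
  have w9 : 2 * u + r ^+ 2 <= 1 / 9 by nra.
  rewrite yE; move: v0; rewrite /v; nra.
- by lra.
Qed.

(* The choice s^2 = sg^2 + |spike|^2, for which y has the same variance at b and
   at the alternatives b + spike rho S. *)
Lemma detect_matched (R : realType) n p (sg s x g : R) (b : 'cV[R]_p) k
    (A : set (data R n p)) :
  0 < sg -> 0 < s -> s ^+ 2 = sg ^+ 2 * (1 + k%:R * x) ->
  (0 < k)%N -> 18 * k%:R <= p%:R `^ g -> g < 1 / 2 -> 0 <= x ->
  9 / 8 * n%:R * x <= (1 - 2 * g) * ln p%:R -> k%:R * x <= 1 / 27 ->
  measurable A -> ((3 / 8)%:E <= law n (Param b 1%:M s) A)%E ->
  exists2 S : {set 'I_p}, #|S| = k &
    ((1 / 32)%:E <= law n (Param (b + spike (sg * Num.sqrt x) S) 1%:M sg) A)%E.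
Proof.
move=> sg0 s0 sE k0 kp g2 x0 tx kx mA PA.
have t0 : 0 <= 9 / 8 * n%:R * x by rewrite !mulr_ge0.
have [m0 sm] := match_small k0 kp g2 (introT andP (conj t0 tx)).
have rhoE : (sg * Num.sqrt x) ^+ 2 = sg ^+ 2 * x.
  by rewrite exprMn sqr_sqrtr.
have sg20 : 0 < sg ^+ 2 by rewrite exprn_gt0.
(* For this s the two factors under the root coincide, so no r^2 term is left and w = 0; this frees
   the dense case from the constraint k <= sqrt n / log p. *)
apply: (@prior_detect R n p sg s (sg * Num.sqrt x) (9 / 8 * n%:R * x) 0 b k
  (p %/ k) A) => //.
- by rewrite mulnC leq_trunc_div.
- by rewrite rhoE sE; nra.
- move=> J Jk; rewrite rhoE sE addr0.
  set r := k%:R * x in kx *.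
  set u := J%:R * x.
  have ur : 0 <= u <= r by rewrite mulr_ge0//= ler_wpM2r// ler_nat.
  have -> : (sg ^+ 2 + k%:R * (sg ^+ 2 * x) - J%:R * (sg ^+ 2 * x)) *
     (2 * (sg ^+ 2 * (1 + r)) - sg ^+ 2 - k%:R * (sg ^+ 2 * x) -
      J%:R * (sg ^+ 2 * x)) =
    (sg ^+ 2 * (1 + r - u)) ^+ 2 by rewrite /r /u; ring.
  move/andP: ur => [u0 ur].
  have y0 : 0 < 1 + r - u by lra.
  rewrite sqrtr_sqr gtr0_norm ?mulr_gt0//.
  have -> : sg ^+ 2 * (1 + r) / (sg ^+ 2 * (1 + r - u)) = (1 + r) / (1 + r - u).
    by field; rewrite !gt_eqF.
  have -> : 9 / 8 * n%:R * x * J%:R = n%:R * (9 / 8 * u) by rewrite /u; field.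
  rewrite expRM_natl lerXn2r ?nnegrE ?expR_ge0//; first by rewrite divr_ge0//; lra.
  apply: (le_trans _ (expR_ge1Dx _)).
  by rewrite ler_pdivrMr//; nra.
- by rewrite add0r; lra.
Qed.

(** * Risk bounds for the two pairs of families *)

Lemma powR_invn_sqr (R : realType) (q x : R) : (x `^ q^-1) ^+ 2 = x `^ (2 / q).
Proof. by rewrite -powR_mulrn ?powR_ge0// -powRrM mulrC. Qed.

Lemma sqrt2_lt_powR (R : realType) (q : R) : 0 < q -> q < 2 ->
  1 < 2 `^ q^-1 / Num.sqrt 2.
Proof.
move=> q0 q2; rewrite ltr_pdivlMr ?sqrtr_gt0// mul1r -powR12_sqrt//.
rewrite /powR gt_eqF// ltr_expR ltr_pM2r; last by rewrite ln_gt0//; lra.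
by rewrite ltf_pV2 ?posrE.
Qed.

Lemma risk_known (R : realType) n p k k1 (q sg a x g rate : R) (b : 'cV[R]_p)
    (bhat : {mfun data R n p >-> p.-tuple R}) :
  1 <= q -> 0 < sg -> (0 < k1)%N -> (l0norm b + k1 <= k)%N ->
  18 * k1%:R <= p%:R `^ g -> g < 1 / 2 -> 0 <= x ->
  9 / 8 * n%:R * x <= (1 - 2 * g) * ln p%:R ->
  k1%:R * x <= 1 / 27 -> n%:R * (k1%:R * x) ^+ 2 <= 4 / 9 -> 0 <= a ->
  (law n (Param b 1%:M sg) [set z | (loss q bhat b z > a)%R] <= (1 / 4)%:E)%E ->
  a <= 3 / 16 * (k1%:R `^ (2 / q) * (sg ^+ 2 * x)) ->
  rate <= 1 / 16 * (k1%:R `^ (2 / q) * (sg ^+ 2 * x)) ->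
  ((1 / 32)%:E <= minimax_risk q sg k bhat rate)%E.
Proof.
move=> q1 sg0 k10 bk kp g2 x0 tx kx nkx a0 good aW rateW.
set W := k1%:R `^ q^-1 * (sg * Num.sqrt x).
have WE : W ^+ 2 = k1%:R `^ (2 / q) * (sg ^+ 2 * x).
  by rewrite /W !exprMn powR_invn_sqr sqr_sqrtr.
have W0 : 0 <= W by rewrite !mulr_ge0 ?powR_ge0 ?sqrtr_ge0// ltW.
have saE : Num.sqrt a ^+ 2 = a by rewrite sqr_sqrtr.
have sa0 : 0 <= Num.sqrt a by rewrite sqrtr_ge0.
rewrite -WE in aW rateW.
(* (7/16)^2 = 49/256 exceeds 3/16 = 48/256. Then (W - sqrt a)^2 - a = W^2 - 2 W sqrt a is at least
   W^2 / 8, twice the admissible rate. *)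
have saW : Num.sqrt a <= 7 / 16 * W.
  rewrite -(@ler_pXn2r _ 2) ?nnegrE//; last by rewrite mulr_ge0.
  by rewrite saE exprMn; have := sqr_ge0 W; lra.
apply: (@two_prior_risk R n p k q sg sg a (sg * Num.sqrt x) 0 rate k1 0 b) => //.
- by rewrite mulr_ge0 ?sqrtr_ge0// ltW.
- by rewrite addn0 (leq_trans _ bk)// leq_addr.
- by move=> A mA PA; exact: (detect_known sg0 k10 kp g2 x0 tx kx nkx mA PA).
- move=> A mA PA; exists finset.set0; first by rewrite cards0.
  have -> : spike 0 finset.set0 = 0 :> 'cV[R]_p.
    by apply/colP => j; rewrite !mxE; case: ifP.
  by rewrite addr0 (le_trans _ PA)// lee_fin; lra.
- by rewrite -/W; lra.
- rewrite -/W mulr0 add0r.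
  have := mulr_ge0 W0 (_ : 0 <= 7 / 16 * W - Num.sqrt a); rewrite subr_ge0.
  by move=> /(_ saW); rewrite saE; lra.
Qed.

(** The difference of squares is (kap + 1) W ((kap - 1) W - 2 S), which is at least (kap - 1) W^2
    for such S. *)
Lemma sqr_separation (R : realFieldType) (kap W S rate : R) :
  1 < kap -> 0 <= W -> S <= (kap - 1) / 4 * W -> rate <= (kap - 1) / 2 * W ^+ 2 ->
  (W + S) ^+ 2 + 2 * rate <= (kap * W - S) ^+ 2.
Proof.
move=> kap1 W0 SW rW.
have H1 : 0 <= (kap + 1) * W * ((kap - 1) / 4 * W - S).
  by rewrite !mulr_ge0//; lra.
have H2 : 0 <= ((kap - 1) * W) ^+ 2 by rewrite sqr_ge0.
have H3 : (kap * W - S) ^+ 2 - (W + S) ^+ 2 = 2 * ((kap - 1) / 2 * W ^+ 2) +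
  ((kap - 1) * W) ^+ 2 / 2 + 2 * ((kap + 1) * W * ((kap - 1) / 4 * W - S)).
  by field.
lra.
Qed.

(* Two families with equal l2 norm, so that s matches both; for q < 2 the wider
   family has the larger lq norm. *)
Lemma risk_unknown (R : realType) n p k m (q sg s a x g rate : R) (b : 'cV[R]_p)
    (bhat : {mfun data R n p >-> p.-tuple R}) :
  let kap := 2 `^ q^-1 / Num.sqrt 2 in
  1 <= q < 2 -> 0 < sg -> 0 < s -> s ^+ 2 = sg ^+ 2 * (1 + m%:R * x) ->
  (0 < m)%N -> (l0norm b + 2 * m <= k)%N ->
  18 * (2 * m)%:R <= p%:R `^ g -> g < 1 / 2 -> 0 <= x ->
  9 / 8 * n%:R * x <= (1 - 2 * g) * ln p%:R ->
  m%:R * x <= 1 / 27 -> 0 <= a ->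
  (law n (Param b 1%:M s) [set z | (loss q bhat b z > a)%R] <= (1 / 4)%:E)%E ->
  a <= (kap - 1) ^+ 2 / 16 * (m%:R `^ (2 / q) * (sg ^+ 2 * x)) ->
  rate <= (kap - 1) / 2 * (m%:R `^ (2 / q) * (sg ^+ 2 * x)) ->
  ((1 / 32)%:E <= minimax_risk q sg k bhat rate)%E.
Proof.
move=> kap /andP[q1 q2] sg0 s0 sE m0 bk kp g2 x0 tx kx a0 good aW rateW.
have q0 : 0 < q by rewrite (lt_le_trans _ q1).
have kap1 : 1 < kap by exact: sqrt2_lt_powR.
set W := m%:R `^ q^-1 * (sg * Num.sqrt x).
have WE : W ^+ 2 = m%:R `^ (2 / q) * (sg ^+ 2 * x).
  by rewrite /W !exprMn powR_invn_sqr sqr_sqrtr.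
have W0 : 0 <= W by rewrite !mulr_ge0 ?powR_ge0 ?sqrtr_ge0// ltW.
(* Doubling the support and halving the squared height keeps the 2-norm and multiplies the q-norm by
   [kap]. *)
have WE' : (2 * m)%:R `^ q^-1 * (sg * Num.sqrt (x / 2)) = kap * W.
  rewrite natrM powRM// sqrtrM// sqrtrV// /kap /W; ring.
have saE : Num.sqrt a ^+ 2 = a by rewrite sqr_sqrtr.
have sa0 : 0 <= Num.sqrt a by rewrite sqrtr_ge0.
rewrite -WE in aW rateW; move: kap kap1 aW rateW WE' => {}kap kap1 aW rateW WE'.
have saW : Num.sqrt a <= (kap - 1) / 4 * W.
  rewrite -(@ler_pXn2r _ 2) ?nnegrE//; last by rewrite mulr_ge0//; lra.
  by rewrite saE (le_trans aW)// le_eqVlt; apply/orP; left; apply/eqP; field.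
have mm : 18 * m%:R <= p%:R `^ g.
  by apply: le_trans kp; rewrite ler_wpM2l// ler_nat leq_pmull.
apply: (@two_prior_risk R n p k q sg s a (sg * Num.sqrt (x / 2))
  (sg * Num.sqrt x) rate (2 * m) m b) => //.
- by rewrite mulr_ge0 ?sqrtr_ge0// ltW.
- by rewrite mulr_ge0 ?sqrtr_ge0// ltW.
- by rewrite (leq_trans _ bk)// leq_add2l leq_pmull.
- move=> A mA PA.
  have sE' : s ^+ 2 = sg ^+ 2 * (1 + (2 * m)%:R * (x / 2)).
    by rewrite sE natrM; field.
  have m20 : (0 < 2 * m)%N by rewrite muln_gt0.
  apply: (detect_matched sg0 s0 sE' m20 kp g2 _ _ _ mA PA); first by rewrite divr_ge0.
  + apply: le_trans tx; rewrite ler_wpM2l ?mulr_ge0//; lra.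
  + by move: kx; rewrite natrM; lra.
- move=> A mA PA; exact: (detect_matched sg0 s0 sE m0 mm g2 x0 tx kx mA PA).
- rewrite WE' (le_trans saW)// ler_wpM2r//; lra.
- by rewrite WE' -/W; exact: sqr_separation.
Qed.

(** Settles k = 0, where the rates vanish and the error event is the whole space. *)
Lemma risk_rate0 (R : realType) n p k (q sg : R)
    (bhat : {mfun data R n p >-> p.-tuple R}) :
  ((1 / 32)%:E <= minimax_risk q sg k bhat 0)%E.
Proof.
apply/ereal_infP => _ [L _ <-].
apply: le_ereal_sup_tmp; eexists.
  exists (Param 0 1%:M sg) => //; split => //=.
  by rewrite /l0norm (eq_card0 (A := _))// => j; rewrite !inE mxE eqxx.
rewrite (_ : [set z | _] = setT); last first.
  by apply/seteqP; split => z //= _.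
by rewrite probability_setT lee_fin; lra.
Qed.

(** * Consequences of the sparsity conditions *)

(** 1/18 is 2/3 times 1/12: the term with the square root is at most 2/3 eps1, by ln (1 + x) <= x,
    and eps1 < 1/12. *)
Lemma c0_bounds (R : realType) (alpha alpha0 gamma Cstar : R) :
  0 < alpha < 1 / 4 -> 0 <= alpha0 < 1 / 4 -> gamma < 1 / 2 -> 0 < Cstar ->
  [/\ 0 < c0 alpha alpha0 gamma Cstar, c0 alpha alpha0 gamma Cstar <= 1 / 18 &
      Cstar * c0 alpha alpha0 gamma Cstar <= (1 - 2 * gamma) / 16].
Proof.
move=> /andP[a0 a1] /andP[b0 b1] g2 C0.
rewrite /c0; set e := (_ / 12); set l := ln _; set t := (_ / (16 * _)).
have e0 : 0 < e by rewrite /e; lra.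
have e1 : e < 1 / 12 by rewrite /e; lra.
have l0 : 0 < l by rewrite ln_gt0// ltrDl exprn_gt0.
have le2 : l <= e ^+ 2 by apply: le_ln1Dx; apply: lt_trans (exprn_gt0 2 e0); lra.
have sl : Num.sqrt l <= e.
  by rewrite -[e]gtr0_norm// -sqrtr_sqr ler_wsqrtr.
have t0 : 0 < t by rewrite divr_gt0//; lra.
have Ct : Cstar * t = (1 - 2 * gamma) / 16 by rewrite /t; field; rewrite gt_eqF.
have sl0 : 0 < Num.sqrt l by rewrite sqrtr_gt0.
split.
- rewrite !lt_min t0 exprn_gt0//; lra.
- rewrite !ge_min; apply/orP; right; apply/orP; right; apply/orP; left; lra.
- rewrite -Ct ler_pM2l// !ge_min lexx /= !orbT//.
Qed.

Lemma sparsity_bounds (R : realType) (n p k k0 : nat) (c g : R) :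
  0 < c <= 1 / 18 -> (0 < k)%N ->
  k%:R <= c * Num.min (p%:R `^ g) (n%:R / ln p%:R) ->
  k0%:R <= c * Num.min k%:R (Num.sqrt n%:R / ln p%:R) ->
  [/\ (0 < n)%N, 0 < ln p%:R :> R, 18 * k%:R <= p%:R `^ g,
      18 * (k%:R * (ln p%:R / n%:R)) <= 1 :> R & (18 * k0 <= k)%N].
Proof.
move=> /andP[c0 c18] k_gt0 hk hk0.
have kR : 0 < k%:R :> R by rewrite ltr0n.
have kle (z : R) : k%:R <= c * z -> 18 * k%:R <= z.
  move=> kz; have z0 : 0 < z by rewrite -(pmulr_rgt0 _ c0) (lt_le_trans kR).
  nra.
have kpg : 18 * k%:R <= p%:R `^ g.
  by apply: kle; apply: (le_trans hk); rewrite ler_pM2l// ge_min lexx.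
have knl : 18 * k%:R <= n%:R / ln p%:R :> R.
  by apply: kle; apply: (le_trans hk); rewrite ler_pM2l// ge_min lexx orbT.
(* Since 1 / 0 is 0, positivity of the quotient excludes n = 0 and also p <= 1, where the logarithm
   is 0. *)
have nl0 : 0 < n%:R / ln p%:R :> R by lra.
have n0 : (0 < n)%N.
  by rewrite lt0n; apply: contraTneq nl0 => ->; rewrite mul0r ltxx.
have nR : 0 < n%:R :> R by rewrite ltr0n.
have lp0 : 0 < ln p%:R :> R by move: nl0; rewrite pmulr_rgt0// invr_gt0.
split => //.
- by move: knl; rewrite ler_pdivlMr// !mulrA ler_pdivrMr// mul1r.
- rewrite -(ler_nat R) natrM.
  have : k0%:R <= c * k%:R.
    by apply: (le_trans hk0); rewrite ler_pM2l// ge_min lexx.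
  have := mulr_ge0 (ltW kR) (_ : 0 <= 1 / 18 - c); rewrite subr_ge0 => /(_ c18).
  lra.
Qed.

(** * The regimes of k against sqrt n / log p *)

(** This lemma and the next are applied at r = 2 / q, between 1 and 2; they replace u^r by u or u^2,
    so that the constants are free of q. *)
Lemma powR_le_shrink (R : realType) (u r s K : R) : 0 < u <= 1 -> 1 <= r ->
  0 <= s -> 0 <= K -> s <= u * K -> s `^ r <= u * K `^ r.
Proof.
move=> u01 r1 s0 K0 sK; apply: (le_trans _ (ge1r_powRZ u01 K0 r1)).
have u0 : 0 <= u by case/andP: u01 => /ltW.
apply: ge0_ler_powR => //; first by lra.
by rewrite nnegrE mulr_ge0.
Qed.

Lemma powR_le_stretch (R : realType) (u r s K : R) : 1 <= u -> 0 <= r <= 2 ->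
  0 <= s -> 0 <= K -> s <= u * K -> s `^ r <= u ^+ 2 * K `^ r.
Proof.
move=> u1 /andP[r0 r2] s0 K0 sK.
apply: (@le_trans _ _ ((u * K) `^ r)).
  by apply: ge0_ler_powR; rewrite ?nnegrE// mulr_ge0//; lra.
rewrite powRM//; last by lra.
rewrite ler_wpM2r ?powR_ge0// -powR_mulrn; last by lra.
exact: ler_powR.
Qed.

(* The regime in which the smaller of k and sqrt n / log p, called N here, is at
   least 1. *)
Lemma risk_wide (R : realType) n p k k0 (q sg c C g N rate : R) (b : 'cV[R]_p)
    (bhat : {mfun data R n p >-> p.-tuple R}) :
  1 <= q <= 2 -> 0 < sg -> 0 < c <= 1 / 18 -> 0 < C -> 0 <= g < 1 / 2 ->
  C * c <= (1 - 2 * g) / 16 ->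
  (0 < n)%N -> 0 < ln p%:R :> R -> 18 * k%:R <= p%:R `^ g ->
  18 * (k%:R * (ln p%:R / n%:R)) <= 1 :> R -> (18 * k0 <= k)%N ->
  1 <= N -> N <= k%:R -> N <= Num.sqrt n%:R / ln p%:R ->
  (l0norm b <= k0)%N -> (l0norm b)%:R <= c * N ->
  (law n (Param b 1%:M sg) [set z | (loss q bhat b z >
     C * (l0norm b)%:R `^ (2 / q) * (ln p%:R / n%:R) * sg ^+ 2)%R]
     <= (1 / 4)%:E)%E ->
  rate <= (1 - 2 * g) / 96 * (N `^ (2 / q) * (ln p%:R / n%:R) * sg ^+ 2) ->
  ((1 / 32)%:E <= minimax_risk q sg k bhat rate)%E.
Proof.
move=> /andP[q1 q2] sg0 /andP[c0 c18] C0 /andP[g0 g2] Cc n0 lp0 kp kn k0k N1 Nk Ns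
  bk0 bN good rateN.
have q0 : 0 < q by lra.
have nR : 0 < n%:R :> R by rewrite ltr0n.
set y := ln p%:R / n%:R in kn good rateN *.
have y0 : 0 < y by rewrite divr_gt0.
have ny : n%:R * y = ln p%:R by rewrite /y mulrC divfK ?gt_eqF.
set h := 1 - 2 * g in Cc rateN.
have h0 : 0 < h by rewrite /h; lra.
have h1 : h <= 1 by rewrite /h; lra.
have N20 : 0 <= N / 2 by lra.
have /andP[tN Nt] := truncn_itv N20.
(* The number of spikes t + 1 lies between N / 2 and N: for t = 0 because N >= 1, otherwise because
   t + 1 <= 2 t. Taking about half of N leaves room for the support of b within k. *)
set t := Num.truncn (N / 2) in tN Nt.
have k1N : t.+1%:R <= N.
  rewrite -natr1; have [t0|t0] := posnP t; first by rewrite t0 add0r.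
  have : 1 <= t%:R :> R by rewrite ler1n.
  lra.
have k1k : (l0norm b + t.+1 <= k)%N.
  have : (2 * t <= k)%N by rewrite -(ler_nat R) natrM; lra.
  have : (0 < k)%N by rewrite -(ltr_nat R); lra.
  clear -bk0 k0k; lia.
have r1 : 1 <= 2 / q by rewrite ler_pdivlMr// mul1r.
have r2 : 2 / q <= 2 by rewrite ler_pdivrMr//; lra.
have sg20 : 0 < sg ^+ 2 by rewrite exprn_gt0.
set K := t.+1%:R : R in Nt k1N.
have K0 : 0 <= K by rewrite ler0n.
have ysg : 0 < y * sg ^+ 2 by rewrite mulr_gt0.
have Kx : K * y <= 1 / 18 by have := ler_wpM2r (ltW y0) (le_trans k1N Nk); lra.
have x0 : 0 <= 2 / 3 * h * y by rewrite !mulr_ge0// ltW.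
(* The factor 2/3 meets the limits of [risk_known]: 9/8 * 2/3 = 3/4 < 1, 2/3 * 1/18 = 1/27 and
   (2/3)^2 = 4/9. *)
apply: (@risk_known R n p k t.+1 q sg
  (C * (l0norm b)%:R `^ (2 / q) * y * sg ^+ 2) (2 / 3 * h * y) g rate b) => //.
- by apply: le_trans kp; rewrite ler_wpM2l//; rewrite -/K; lra.
- rewrite -/h.
  have -> : 9 / 8 * n%:R * (2 / 3 * h * y) = 3 / 4 * (h * (n%:R * y)) by field.
  by rewrite ny; have := mulr_ge0 (ltW h0) (ltW lp0); lra.
- rewrite -/K.
  have -> : K * (2 / 3 * h * y) = h * (2 / 3 * (K * y)) by field.
  apply: (@le_trans _ _ (1 * (2 / 3 * (K * y)))); last by lra.
  by rewrite ler_wpM2r// !mulr_ge0// ltW.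
- rewrite -/K.
  have -> : n%:R * (K * (2 / 3 * h * y)) ^+ 2 =
      (4 / 9) * (h ^+ 2 * ((K * (n%:R * y)) ^+ 2 / n%:R)).
    by field; rewrite gt_eqF.
  rewrite ny.
  have H : (K * ln p%:R) ^+ 2 <= n%:R.
    rewrite -[leRHS]sqr_sqrtr ?ler0n// ler_pXn2r ?nnegrE ?sqrtr_ge0//; last first.
      by rewrite mulr_ge0// ltW.
    by rewrite -ler_pdivlMr// (le_trans k1N).
  have H1 : (K * ln p%:R) ^+ 2 / n%:R <= 1 by rewrite ler_pdivrMr// mul1r.
  rewrite -[leRHS]mulr1 ler_wpM2l//.
  rewrite mulr_ile1// ?sqr_ge0// ?divr_ge0 ?sqr_ge0//.
  by rewrite expr_le1// ltW.
- have P0 := powR_ge0 (l0norm b)%:R (2 / q : R).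
  have S0 := ltW sg20; have Y0 := ltW y0; have C'0 := ltW C0.
  exact: mulr_ge0 (mulr_ge0 (mulr_ge0 C'0 P0) Y0) S0.
(* The error budget is met exactly: 2 C c <= h / 8 = 3/16 * 2/3 h. *)
- have : (l0norm b)%:R `^ (2 / q) <= 2 * c * K `^ (2 / q).
    apply: powR_le_shrink => //; first by lra.
    by apply: (le_trans bN); rewrite -mulrA mulrCA ler_pM2l//; lra.
  rewrite -/K => H.
  apply: (@le_trans _ _ (C * (2 * c * K `^ (2 / q)) * y * sg ^+ 2)).
    rewrite -!(mulrA _ y).
    exact: (ler_wpM2r (ltW ysg) (ler_wpM2l (ltW C0) H)).
  have -> : C * (2 * c * K `^ (2 / q)) * y * sg ^+ 2 =
    2 * (C * c) * (K `^ (2 / q) * (y * sg ^+ 2)) by ring.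
  have -> : 3 / 16 * (K `^ (2 / q) * (sg ^+ 2 * (2 / 3 * h * y))) =
    2 * (h / 16) * (K `^ (2 / q) * (y * sg ^+ 2)) by field.
  apply: ler_wpM2r; last by lra.
  exact: mulr_ge0 (powR_ge0 _ _) (ltW ysg).
- apply: (le_trans rateN); rewrite -/K.
  have : N `^ (2 / q) <= 2 ^+ 2 * K `^ (2 / q).
    apply: powR_le_stretch => //; [lra|lra|lra|].
    by lra.
  rewrite -(mulrA _ y) => /(ler_wpM2r (ltW ysg)) H.
  have h96 : 0 <= h / 96 by lra.
  apply: (le_trans (ler_wpM2l h96 H)).
  by rewrite le_eqVlt; apply/orP; left; apply/eqP; field.
Qed.

(* The case sqrt n < log p of q = 2, where one spike suffices. *)
Lemma risk_single (R : realType) n p k (sg g rate : R) (b : 'cV[R]_p)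
    (bhat : {mfun data R n p >-> p.-tuple R}) :
  0 < sg -> 0 <= g < 1 / 2 -> (0 < n)%N -> (0 < k)%N ->
  18 * k%:R <= p%:R `^ g ->
  18 * (k%:R * (ln p%:R / n%:R)) <= 1 :> R ->
  Num.sqrt n%:R < ln p%:R :> R -> l0norm b = 0 ->
  (law n (Param b 1%:M sg) [set z | (loss 2 bhat b z > 0)%R]
     <= (1 / 4)%:E)%E ->
  rate <= (1 - 2 * g) / 24 * ((Num.sqrt n%:R)^-1 * sg ^+ 2) ->
  ((1 / 32)%:E <= minimax_risk 2 sg k bhat rate)%E.
Proof.
move=> sg0 /andP[g0 g2] n0 k0 kp kn snl b0 good rateW.
have nR : 0 < n%:R :> R by rewrite ltr0n.
have kR : 1 <= k%:R :> R by rewrite ler1n.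
set r := Num.sqrt n%:R in snl rateW.
have r0 : 0 < r by rewrite sqrtr_gt0.
have rr : r ^+ 2 = n%:R by rewrite sqr_sqrtr ?ltW.
have sg20 : 0 < sg ^+ 2 by rewrite exprn_gt0.
set h := 1 - 2 * g in rateW.
have h0 : 0 < h by rewrite /h; lra.
have h1 : h <= 1 by rewrite /h; lra.
have lp0 : 0 < ln p%:R :> R by exact: lt_trans snl.
have y18 : ln p%:R / n%:R <= 1 / 18 :> R.
  have : 0 < ln p%:R / n%:R :> R by rewrite divr_gt0.
  nra.
have rV : r^-1 <= 1 / 18.
  apply: le_trans y18; rewrite -rr -ler_pdivrMr ?invr_gt0 ?exprn_gt0//.
  by rewrite invrK expr2 mulrA mulVf ?gt_eqF// mul1r ltW.
have rV0 : 0 < r^-1 by rewrite invr_gt0.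
have x0 : 0 <= 2 / 3 * h * r^-1 by rewrite !mulr_ge0// ltW.
have hr : h * r^-1 <= 1 * r^-1 by rewrite ler_wpM2r// ltW.
(* As b = 0, [bhat] is exact on the good event, so a = 0. The squared height is of order 1 / sqrt n,
   the largest order allowed by n x^2 <= 4/9. *)
apply: (@risk_known R n p k 1 2 sg 0 (2 / 3 * h * r^-1) g rate b) => //.
- by lra.
- by rewrite b0.
- by apply: le_trans kp; rewrite ler_wpM2l.
- rewrite -/h -rr.
  have -> : 9 / 8 * r ^+ 2 * (2 / 3 * h * r^-1) = 3 / 4 * (h * r).
    by field; rewrite gt_eqF.
  have : h * r <= h * ln p%:R by rewrite ler_wpM2l// ltW.
  have : 0 <= h * r by rewrite mulr_ge0// ltW.
  lra.
- by lra.
- have -> : n%:R * (1%:R * (2 / 3 * h * r^-1)) ^+ 2 = 4 / 9 * h ^+ 2.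
    by rewrite -rr; field; rewrite gt_eqF.
  have : h ^+ 2 <= 1 by rewrite expr_le1// ltW.
  lra.
- apply: mulr_ge0; first by lra.
  exact: mulr_ge0 (powR_ge0 _ _) (mulr_ge0 (ltW sg20) x0).
- apply: (le_trans rateW).
  by rewrite powR1 le_eqVlt; apply/orP; left; apply/eqP; field; rewrite gt_eqF.
Qed.

(* The regime in which the noise level at b is tuned to hide the spikes, at the
   price of an error bound for bhat that only holds at that noise level. *)
Lemma risk_dense (R : realType) n p k k0 (q sg C g M rate : R) (b : 'cV[R]_p)
    (bhat : {mfun data R n p >-> p.-tuple R}) :
  let kap := 2 `^ q^-1 / Num.sqrt 2 in
  1 <= q < 2 -> 0 < sg -> 0 < C -> 0 <= g < 1 / 2 -> 3 <= M ->
  144 * C <= M * ((kap - 1) ^+ 2 * (1 - 2 * g)) ->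
  (0 < n)%N -> (1 < k)%N -> 0 < ln p%:R :> R -> 18 * k%:R <= p%:R `^ g ->
  18 * (k%:R * (ln p%:R / n%:R)) <= 1 :> R -> (18 * k0 <= k)%N ->
  (l0norm b <= k0)%N -> (l0norm b)%:R <= k%:R / M ->
  (forall s : R, 0 < s <= 2 * sg ->
    (law n (Param b 1%:M s) [set z | (loss q bhat b z >
     C * (l0norm b)%:R `^ (2 / q) * (ln p%:R / n%:R) * s ^+ 2)%R]
     <= (1 / 4)%:E)%E) ->
  rate <= (kap - 1) * (1 - 2 * g) / 27 *
    (k%:R `^ (2 / q) * (ln p%:R / n%:R) * sg ^+ 2) ->
  ((1 / 32)%:E <= minimax_risk q sg k bhat rate)%E.
Proof.
move=> kap /andP[q1 q2] sg0 C0 /andP[g0 g2] M3 CM n0 k1 lp0 kp kn k0k bk0 bM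
  good rateW.
have q0 : 0 < q by lra.
have nR : 0 < n%:R :> R by rewrite ltr0n.
have kap1 : 1 < kap by exact: sqrt2_lt_powR.
set y := ln p%:R / n%:R in kn good rateW *.
have y0 : 0 < y by rewrite divr_gt0.
have ny : n%:R * y = ln p%:R by rewrite /y mulrC divfK ?gt_eqF.
set h := 1 - 2 * g in CM rateW.
have h0 : 0 < h by rewrite /h; lra.
have h1 : h <= 1 by rewrite /h; lra.
have sg20 : 0 < sg ^+ 2 by rewrite exprn_gt0.
have ysg : 0 < y * sg ^+ 2 by rewrite mulr_gt0.
have r1 : 1 <= 2 / q by rewrite ler_pdivlMr// mul1r ltW.
have r2 : 2 / q <= 2 by rewrite ler_pdivrMr//; lra.
(* The wide family of 2 m spikes fits next to the support of b; k > 1 is what makes m positive. *)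
pose m := ((k - k0) %/ 2)%N.
have [m0 km mk] : [/\ (0 < m)%N, (k <= 3 * m)%N & (l0norm b + 2 * m <= k)%N].
  rewrite /m; move: (l0norm b) bk0 => l lk0; clear -k0k k1 lk0; split; lia.
set K := m%:R : R.
have K0 : 0 <= K by rewrite ler0n.
have kK : k%:R <= 3 * K by rewrite -natrM ler_nat.
have mk' : (2 * m <= k)%N by rewrite (leq_trans _ mk)// leq_addl.
have Kk : 2 * K <= k%:R by rewrite -natrM ler_nat.
have x0 : 0 <= 2 / 3 * h * y by rewrite !mulr_ge0// ltW.
have Ky : K * y <= 1 / 36 by have := ler_wpM2r (ltW y0) Kk; lra.
have Ky0 : 0 <= K * y by rewrite mulr_ge0// ltW.
have Kx : K * (2 / 3 * h * y) <= 1 / 27.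
  have -> : K * (2 / 3 * h * y) = h * (2 / 3 * (K * y)) by field.
  apply: (@le_trans _ _ (1 * (2 / 3 * (K * y)))); last by lra.
  by rewrite ler_wpM2r//; lra.
have Kx0 : 0 <= K * (2 / 3 * h * y) by rewrite mulr_ge0.
have s1 : 0 < 1 + K * (2 / 3 * h * y) by lra.
have [s s0 sE] : exists2 s : R, 0 < s & s ^+ 2 = sg ^+ 2 * (1 + K * (2 / 3 * h * y)).
  exists (sg * Num.sqrt (1 + K * (2 / 3 * h * y))).
    by rewrite mulr_gt0 ?sqrtr_gt0.
  by rewrite exprMn sqr_sqrtr ?ltW.
have s2 : s ^+ 2 <= 2 * sg ^+ 2.
  by rewrite sE mulrC ler_wpM2r ?(ltW sg20)//; lra.
have ssg : 0 < s <= 2 * sg.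
  rewrite s0/= -(@ler_pXn2r _ 2) ?nnegrE ?(ltW s0)//; last by lra.
  have -> : (2 * sg) ^+ 2 = 4 * sg ^+ 2 by ring.
  by lra.
have P0 := powR_ge0 (l0norm b)%:R (2 / q : R).
have PK0 := powR_ge0 K (2 / q : R).
apply: (@risk_unknown R n p k m q sg s
  (C * (l0norm b)%:R `^ (2 / q) * y * s ^+ 2) (2 / 3 * h * y) g rate b) => //.
- by rewrite q1.
- by apply: le_trans kp; rewrite ler_wpM2l// ler_nat.
- rewrite -/h.
  have -> : 9 / 8 * n%:R * (2 / 3 * h * y) = 3 / 4 * (h * (n%:R * y)) by field.
  by rewrite ny; have := mulr_ge0 (ltW h0) (ltW lp0); lra.
- exact: mulr_ge0 (mulr_ge0 (mulr_ge0 (ltW C0) P0) (ltW y0)) (sqr_ge0 s).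
- exact: good.
- rewrite -/kap -/K.
  have : (l0norm b)%:R `^ (2 / q) <= 3 / M * K `^ (2 / q).
    apply: powR_le_shrink => //.
      apply/andP; split; first by rewrite divr_gt0//; lra.
      by rewrite ler_pdivrMr ?mul1r//; lra.
    apply: (le_trans bM); rewrite mulrAC ler_pM2r// invr_gt0; lra.
  move=> /(ler_wpM2l (ltW C0)) H.
  (* The 6 combines l0norm b <= 3 K / M with s^2 <= 2 sg^2, and 1/24 is 1/16 * 2/3; hence the 144 in
     the condition on M. *)
  have CM' : 6 * C / M <= (kap - 1) ^+ 2 * h / 24.
    by rewrite ler_pdivrMr; lra.
  apply: (@le_trans _ _ (C * (3 / M * K `^ (2 / q)) * (y * (2 * sg ^+ 2)))).
    rewrite -(mulrA _ y); apply: ler_pM => //.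
    - exact: mulr_ge0 (ltW C0) P0.
    - exact: mulr_ge0 (ltW y0) (sqr_ge0 s).
    - exact: (ler_wpM2l (ltW y0) s2).
  have -> : C * (3 / M * K `^ (2 / q)) * (y * (2 * sg ^+ 2)) =
    6 * C / M * (K `^ (2 / q) * (y * sg ^+ 2)) by field; rewrite gt_eqF//; lra.
  have -> : (kap - 1) ^+ 2 / 16 * (K `^ (2 / q) * (sg ^+ 2 * (2 / 3 * h * y))) =
    (kap - 1) ^+ 2 * h / 24 * (K `^ (2 / q) * (y * sg ^+ 2)) by field.
  apply: ler_wpM2r => //.
  exact: mulr_ge0 PK0 (ltW ysg).
- apply: (le_trans rateW); rewrite -/K -/kap.
  have : k%:R `^ (2 / q) <= 3 ^+ 2 * K `^ (2 / q).
    by apply: powR_le_stretch => //; lra.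
  rewrite -(mulrA _ y) => /(ler_wpM2r (ltW ysg)) H.
  have kh : 0 <= (kap - 1) * h / 27.
    by rewrite divr_ge0// mulr_ge0// ?(ltW h0)//; lra.
  apply: (le_trans (ler_wpM2l kh H)).
  by rewrite le_eqVlt; apply/orP; left; apply/eqP; field.
Qed.

Lemma natr_lt1_eq0 (R : realType) (m m0 : nat) (c N : R) : (m <= m0)%N ->
  0 < c <= 1 / 18 -> m0%:R <= c * N -> N < 1 -> m = 0%N.
Proof.
move=> mm0 /andP[c0 c18] mN N1.
have : c * N < c by rewrite gtr_pMr.
have : m%:R <= m0%:R :> R by rewrite ler_nat.
move=> ? ?; have : m%:R < 1 :> R by lra.
by rewrite (ltr_nat R m 1) ltnS leqn0 => /eqP.
Qed.

Theorem theorem1 (R : realType) (alpha alpha0 Cstar gamma sigma0 : R)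
    (halpha : 0 < alpha < 1 / 4) (halpha0 : 0 <= alpha0 < 1 / 4)
    (hCstar : 0 < Cstar) (hgamma : 0 <= gamma < 1 / 2) (hsigma0 : 0 < sigma0) :
  let c_0 := c0 alpha alpha0 gamma Cstar in
  let sparsity (n p k k0 : nat) : Prop :=
    k%:R <= c_0 * Num.min (p%:R `^ gamma) (n%:R / ln p%:R) /\
    k0%:R <= c_0 * Num.min k%:R (Num.sqrt n%:R / ln p%:R) in
  (exists c delta : R, [/\ 0 < c, 0 < delta &
    forall (n p k k0 : nat) (bhat : {mfun data R n p >-> p.-tuple R}),
      sparsity n p k k0 ->
      (exists theta0 : param R p,
        [/\ Theta0 sigma0 k theta0, (l0norm (beta theta0) <= k0)%N &
          (law n theta0 [set z | (loss 2%R bhat (beta theta0) z >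
             Cstar * (l0norm (beta theta0))%:R * (ln p%:R / n%:R)
               * sigma0 ^+ 2)%R]
           <= alpha0%:E)%E]) ->
      (delta%:E <= minimax_risk 2%R sigma0 k bhat
        (c * Num.min (k%:R * (ln p%:R / n%:R)) (Num.sqrt n%:R)^-1
           * sigma0 ^+ 2)%R)%E])
  /\
  (forall q : R, 1 <= q < 2 ->
   exists c delta : R, [/\ 0 < c, 0 < delta &
    forall (n p k k0 : nat) (bhat : {mfun data R n p >-> p.-tuple R}),
      sparsity n p k k0 ->
      (* 1-sparse vectors have equal lq and l2 norms, so that for k = 1 and
         log p > sqrt n the bound would contradict the 1 / sqrt n rate that
         is attained for q = 2 *)
      (k = 1%N -> ln p%:R <= Num.sqrt n%:R :> R) ->
      (exists bstar : 'cV[R]_p,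
        (l0norm bstar <= k0)%N /\
        (ereal_sup [set law n theta [set z | (loss q bhat bstar z >
             Cstar * (l0norm bstar)%:R `^ (2 / q) * (ln p%:R / n%:R)
               * sigma theta ^+ 2)%R]
           | theta in [set theta : param R p |
               [/\ beta theta = bstar, Sigma theta = 1%:M &
                   (0 < sigma theta <= 2 * sigma0)%R]]]
         <= alpha0%:E)%E) ->
      (delta%:E <= minimax_risk q sigma0 k bhat
        (c * k%:R `^ (2 / q) * (ln p%:R / n%:R) * sigma0 ^+ 2)%R)%E]).
Proof.
move=> c_0 sparsity.
have /andP[g0 g2] := hgamma; have /andP[al0 al4] := halpha0.
have [cp c18 Cc] := c0_bounds halpha halpha0 g2 hCstar.
rewrite -/c_0 in cp c18 Cc.
have cc : 0 < c_0 <= 1 / 18 by rewrite cp.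
set h := 1 - 2 * gamma in Cc.
have h0 : 0 < h by rewrite /h; lra.
have al14 : (alpha0%:E <= (1 / 4)%:E)%E by rewrite lee_fin ltW.
have sg20 : 0 < sigma0 ^+ 2 by rewrite exprn_gt0.
split=> [|q /andP[q1 q2]].
  exists (h / 96), (1 / 32); split; [lra|lra|].
  move=> n p k k0 bhat [hk hk0] [[b S s] [[/= bk -> ->] b0 good0]].
  have [->|k_gt0] := posnP k.
    have -> : Num.min (0%:R * (ln p%:R / n%:R)) (Num.sqrt n%:R)^-1 = 0 :> R.
      by rewrite mul0r; apply/min_idPl; rewrite invr_ge0 sqrtr_ge0.
    by rewrite mulr0 mul0r; exact: risk_rate0.
  have [n0 lp0 kp kn k0k] := sparsity_bounds cc k_gt0 hk hk0.
  have nR : 0 < n%:R :> R by rewrite ltr0n.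
  have r0 : 0 < Num.sqrt n%:R :> R by rewrite sqrtr_gt0.
  have y0 : 0 < ln p%:R / n%:R :> R by rewrite divr_gt0.
  have good := le_trans good0 al14.
  have p22 (z : R) : 0 <= z -> z `^ (2 / 2) = z by move=> z0; rewrite divff ?powRr1.
  set N := Num.min k%:R (Num.sqrt n%:R / ln p%:R) in hk0.
  (* If N < 1, then k0 <= c_0 N < 1 forces b = 0, and k >= 1 forces sqrt n < log p. *)
  have [N1|N1] := leP 1 N.
    apply: (@risk_wide R n p k k0 2 sigma0 c_0 Cstar gamma N _ b) => //.
    - by apply/andP; split; lra.
    - by rewrite ge_min lexx.
    - by rewrite ge_min lexx orbT.
    - by apply: le_trans hk0; rewrite ler_nat.
    - by rewrite p22.
    - rewrite p22; last by lra.
      rewrite -/h -(mulrA (h / 96)); apply: ler_wpM2l; first by lra.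
      apply: ler_wpM2r; first exact: ltW.
      rewrite /N; case: (leP k%:R (_ / _)) => _; rewrite ge_min ?lexx//; apply/orP; right.
      rewrite le_eqVlt; apply/orP; left; apply/eqP.
      have : n%:R = Num.sqrt n%:R ^+ 2 :> R by rewrite sqr_sqrtr ?ler0n.
      move: (Num.sqrt n%:R) r0 => r r0 ->.
      by field; rewrite !gt_eqF.
  have b00 := natr_lt1_eq0 b0 cc hk0 N1.
  have kR : 1 <= k%:R :> R by rewrite ler1n.
  have snl : Num.sqrt n%:R < ln p%:R :> R.
    move: N1; rewrite /N gt_min => /orP[|]; first by lra.
    by rewrite ltr_pdivrMr// mul1r.
  apply: (@risk_single R n p k sigma0 gamma _ b) => //.
    by move: good; rewrite b00 mulr0 !mul0r.
  rewrite -/h -mulrA; apply: ler_pM; first by lra.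
  - rewrite mulr_ge0 ?(ltW sg20)// le_min invr_ge0 sqrtr_ge0 andbT.
    by rewrite mulr_ge0// ltW.
  - by lra.
  - by rewrite ler_wpM2r ?(ltW sg20)// ge_min lexx orbT.
have q0 : 0 < q by lra.
pose kap : R := 2 `^ q^-1 / Num.sqrt 2.
have kap1 : 1 < kap by exact: sqrt2_lt_powR.
have kh0 : 0 < (kap - 1) ^+ 2 * h by rewrite mulr_gt0// exprn_gt0//; lra.
(* The threshold on k / N between the two constructions; it grows without bound as q tends to 2. *)
pose M := 3 + 144 * Cstar / ((kap - 1) ^+ 2 * h).
have M3 : 3 <= M by rewrite lerDl divr_ge0 ?(ltW kh0)//; lra.
have MC : 144 * Cstar <= M * ((kap - 1) ^+ 2 * h).
  by rewrite /M (mulrDl 3) divfK ?gt_eqF//; lra.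
clearbody M.
have M20 : 0 < M ^+ 2 by rewrite exprn_gt0//; lra.
pose c := Num.min (h / 96 / M ^+ 2) ((kap - 1) * h / 27).
have c1 : c * M ^+ 2 <= h / 96 by rewrite -ler_pdivlMr// ge_min lexx.
have c2 : c <= (kap - 1) * h / 27 by rewrite ge_min lexx orbT.
have cpos : 0 < c.
  rewrite lt_min; apply/andP; split; first by rewrite divr_gt0//; lra.
  by rewrite divr_gt0// mulr_gt0//; lra.
clearbody c.
exists c, (1 / 32); split; [by []|lra|].
move=> n p k k0 bhat [hk hk0] k1hyp [b [b0 sup]].
have good s : 0 < s <= 2 * sigma0 ->
    (law n (Param b 1%:M s) [set z | (loss q bhat b z >
     Cstar * (l0norm b)%:R `^ (2 / q) * (ln p%:R / n%:R) * s ^+ 2)%R]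
     <= (1 / 4)%:E)%E.
  move=> s0; apply: (le_trans _ (le_trans sup al14)).
  by apply: ereal_sup_ubound; exists (Param b 1%:M s).
have r1 : 1 <= 2 / q by rewrite ler_pdivlMr// mul1r ltW.
have r2 : 2 / q <= 2 by rewrite ler_pdivrMr//; lra.
have [->|k_gt0] := posnP k.
  have -> : 0%:R `^ (2 / q) = 0 :> R by rewrite powR0// gt_eqF//; lra.
  by rewrite mulr0 !mul0r; exact: risk_rate0.
have [n0 lp0 kp kn k0k] := sparsity_bounds cc k_gt0 hk hk0.
have y0 : 0 < ln p%:R / n%:R :> R by rewrite divr_gt0 ?ltr0n.
have kR : 1 <= k%:R :> R by rewrite ler1n.
have ysg : 0 < ln p%:R / n%:R * sigma0 ^+ 2 by rewrite mulr_gt0.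
set N := Num.min k%:R (Num.sqrt n%:R / ln p%:R) in hk0.
have l0N : (l0norm b)%:R <= c_0 * N by apply: le_trans hk0; rewrite ler_nat.
(* When k <= M N, replacing k by N in the rate costs at most the factor M^2, which the first term of
   [c] absorbs. *)
have [/andP[N1 kMN]|wide] := boolP ((1 <= N) && (k%:R <= M * N)).
  apply: (@risk_wide R n p k k0 q sigma0 c_0 Cstar gamma N _ b) => //.
  - by rewrite q1 ltW.
  - by rewrite ge_min lexx.
  - by rewrite ge_min lexx orbT.
  - by apply: good; rewrite hsigma0/=; lra.
  - have H : k%:R `^ (2 / q) <= M ^+ 2 * N `^ (2 / q).
      by apply: powR_le_stretch => //; lra.
    have PN := powR_ge0 N (2 / q : R).
    rewrite -/h -!(mulrA _ (ln p%:R / n%:R)) (mulrA (h / 96)).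
    apply: (ler_wpM2r (ltW ysg)); apply: (le_trans (ler_wpM2l (ltW cpos) H)).
    by rewrite mulrA; exact: (ler_wpM2r PN c1).
apply: (@risk_dense R n p k k0 q sigma0 Cstar gamma M _ b) => //.
- by rewrite q1.
(* For k = 1 the additional hypothesis gives N = 1, so that k <= M N and the other construction
   applies. *)
- rewrite ltn_neqAle k_gt0 andbT eq_sym; apply: contraNneq wide => k1.
  have N1 : 1 <= N.
    by rewrite /N le_min kR ler_pdivlMr// mul1r k1hyp.
  by rewrite N1 k1 /=; apply: mulr_ege1 => //; lra.
- rewrite ler_pdivlMr; last by lra.
  have [N1|N1] := leP 1 N; last by rewrite (natr_lt1_eq0 b0 cc hk0 N1) mul0r; lra.
  move: wide; rewrite N1 /= -ltNge => NM; apply: le_trans (ltW NM).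
  rewrite mulrC ler_wpM2l//; first by lra.
  apply: (le_trans l0N); rewrite ger_pMl; lra.
- have Pk := powR_ge0 k%:R (2 / q : R).
  rewrite -/kap -/h -!(mulrA _ (ln p%:R / n%:R)) (mulrA (_ / 27)).
  exact: (ler_wpM2r (ltW ysg) (ler_wpM2r Pk c2)).
Qed.
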